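(* If $G$ is a finite undirected connected graph such that $\mathrm{MH}_{2,k}(G,\mathbb{Z})=0$ for all $k>2$, then the two-dimensional CW-complex $\mathsf{CW}^2(G)$ is simply connected.
   Context: A digraph consists of a set of vertices and a set of arrows, which are ordered pairs of distinct vertices. An undirected graph is a digraph such that for any arrow $(x,y)$ the pair $(y,x)$ is also an arrow. A path of length $n\ge 0$ is a tuple of vertices $(p_0,\dots,p_n)$ such that each $(p_i,p_{i+1})$ is an arrow; $d(x,y)$ is the infimum of lengths of paths from $x$ to $y$ ($\infty$ if there are none). Put $|x_0,\dots,x_n|=\sum_{i=0}^{n-1}d(x_i,x_{i+1})$. Magnitude homology: $\mathrm{MC}_{n,\ell}(G,\mathbb{Z})$ is the free abelian group on tuples of vertices with $x_i\neq x_{i+1}$ and $|x_0,\dots,x_n|=\ell$; the differential is $\sum_{i=0}^n(-1)^i\partial_{n,i}$, where $\partial_{n,i}$ deletes $x_i$ if the resulting tuple still has norm $\ell$ and is $0$ otherwise. $\mathrm{MH}_{n,\ell}(G,\mathbb{Z})=H_n(\mathrm{MC}_{\bullet,\ell}(G,\mathbb{Z}))$. $\mathsf{CW}^2(G)$ is the two-dimensional CW-complex obtained from the geometric realization of the undirected graph $G$ (a $1$-dimensional complex with one edge for each pair of adjacent vertices) by attaching $2$-cells to all squares (cycles of length $4$ with distinct vertices) and all triangles (cycles of length $3$ with distinct vertices) of $G$. *)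

(* Defs.v *)
From HB Require Import structures.
From mathcomp Require Import all_boot all_order all_algebra.
From mathcomp Require Import all_classical all_reals all_analysis homotopy.
From Stdlib Require Import Relation_Operators Operators_Properties.

Set Implicit Arguments.
Unset Strict Implicit.
Unset Printing Implicit Defensive.

Import Order.TTheory GRing.Theory Num.Theory.
Import numFieldNormedType.Exports.

Local Open Scope classical_set_scope.
Local Open Scope quotient_scope.
Local Open Scope ring_scope.

Section Homology.
Context (A B C : zmodType) (f : {additive A -> B}) (g : {additive B -> C}).

Definition is_cycle : {pred B} := fun b => g b == 0.

Fact is_cycle_zmod_closed : zmod_closed is_cycle.
Proof.
split=> [|x y]; first by rewrite unfold_in /is_cycle raddf0.
by rewrite !unfold_in /is_cycle raddfB => /eqP-> /eqP->; rewrite subrr.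
Qed.

HB.instance Definition _ := GRing.isZmodClosed.Build B is_cycle
  is_cycle_zmod_closed.

Definition cycles := {b : B | b \in is_cycle}.

HB.instance Definition _ := SubChoice.on cycles.
HB.instance Definition _ := [SubChoice_isSubZmodule of cycles by <:].

Definition is_boundary : {pred cycles} := fun z => `[< exists a, f a = val z >].

Fact is_boundary_zmod_closed : zmod_closed is_boundary.
Proof.
split=> [|x y]; first by apply/asboolP; exists 0; rewrite !raddf0.
move=> /asboolP[a fa] /asboolP[b fb]; apply/asboolP.
by exists (a - b); rewrite !raddfB fa fb.
Qed.

HB.instance Definition _ := GRing.isZmodClosed.Build cycles is_boundary
  is_boundary_zmod_closed.

(* ker g / (im f /\ ker g), which is ker g / im f for a complex. *)
Definition homology : zmodType := @Quotient.quot cycles is_boundary.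

End Homology.

Section MagnitudeHomology.
Context (T : finType) (e : rel T).

Definition path_of_length (x y : T) (n : nat) : bool :=
  [exists p : n.-tuple T, path e x p && (last x p == y)].

(* Extended natural numbers are represented by option nat; None is infinity. *)
Definition dist (x y : T) : option nat :=
  if pselect (exists n, path_of_length x y n) is left ex
  then Some (ex_minn ex) else None.

Definition addo (a b : option nat) : option nat :=
  if (a, b) is (Some m, Some n) then Some (m + n)%N else None.

Definition norm (n : nat) (x : n.+1.-tuple T) : option nat :=
  foldr addo (Some 0%N) (pairmap dist (thead x) (behead x)).

Definition is_generator (n l : nat) (x : n.+1.-tuple T) : bool :=
  [forall i : 'I_n, tnth x (widen_ord (leqnSn n) i) != tnth x (lift ord0 i)]
  && (norm x == Some l).

Definition generator (n l : nat) := {x : n.+1.-tuple T | is_generator l x}.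

(* The free abelian group on the finite set of generators. *)
Definition MC (n l : nat) : zmodType := {ffun generator n l -> int}.

Definition delete (n : nat) (i : 'I_n.+2) (x : n.+2.-tuple T) :
  n.+1.-tuple T := [tuple tnth x (lift i j) | j < n.+1].

(* None stands for the zero chain.  A tuple obtained by deletion which still
   has norm l automatically has distinct consecutive entries. *)
Definition face (n l : nat) (i : 'I_n.+2) (x : generator n.+1 l) :
  option (generator n l) := insub (delete i (val x)).

Definition diffS (n l : nat) (c : MC n.+1 l) : MC n l :=
  [ffun y => \sum_(x : generator n.+1 l) \sum_(i < n.+2)
     (-1) ^+ i * c x * (face i x == Some y)%:R].

Definition diff (n l : nat) : MC n l -> MC n.-1 l :=
  match n with 0%N => fun=> 0 | n'.+1 => @diffS n' l end.

Fact diff_is_zmod_morphism (n l : nat) : zmod_morphism (@diff n l).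
Proof.
case: n => [|n] c c'; first by rewrite subrr.
apply/ffunP => y; rewrite !ffunE -sumrB; apply: eq_bigr => x _.
rewrite -sumrB; apply: eq_bigr => i _.
by rewrite !ffunE mulrBr mulrBl.
Qed.

HB.instance Definition _ (n l : nat) :=
  GRing.isZmodMorphism.Build _ _ (@diff n l) (@diff_is_zmod_morphism n l).

Definition MH (n l : nat) : zmodType :=
  homology (@diff n.+1 l : {additive _ -> _}) (@diff n l : {additive _ -> _}).

End MagnitudeHomology.

Section AttachCells.
(* Cells modelled on D are attached to X, one for each i : I.  The attaching
   map of the i-th cell is described through a parametrization bd i of the
   boundary of D by B i: it sends bd i b to phi i b.  The result is the
   quotient of the disjoint union of X and of I copies of D (summands None and
   Some i respectively) by the least equivalence relation identifying each
   bd i b with phi i b. *)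
Context (X : topologicalType) (I : choiceType) (D : topologicalType).
Context (B : I -> Type) (bd : forall i, B i -> D) (phi : forall i, B i -> X).

Definition summand (o : option I) : topologicalType :=
  if o is Some _ then D else X.

Variant glue : {o & summand o} -> {o & summand o} -> Prop :=
  Glue (i : I) (b : B i) :
    glue (existT summand (Some i) (bd b)) (existT summand None (phi b)).

Definition glue_rel (u v : {o & summand o}) : bool :=
  `[< clos_refl_sym_trans _ glue u v >].

Fact glue_rel_refl : reflexive glue_rel.
Proof. by move=> u; apply/asboolP; exact: rst_refl. Qed.

Fact glue_rel_sym : symmetric glue_rel.
Proof. by move=> u v; apply/asboolP/asboolP; exact: rst_sym. Qed.

Fact glue_rel_trans : transitive glue_rel.
Proof.
by move=> v u w /asboolP uv /asboolP vw; apply/asboolP; exact: rst_trans vw.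
Qed.

Definition glue_equiv :=
  EquivRel glue_rel glue_rel_refl glue_rel_sym glue_rel_trans.

Definition attach : topologicalType :=
  quotient_topology {eq_quot glue_equiv}.

Definition attach_base (x : X) : attach :=
  \pi_({eq_quot glue_equiv}) (existT summand None x).

Definition attach_cell (i : I) (d : D) : attach :=
  \pi_({eq_quot glue_equiv}) (existT summand (Some i) d).

End AttachCells.

Section UnitInterval.
Context (R : realType).

Definition unit_interval : Type := set_type (`[0, 1]%classic : set R).
HB.instance Definition _ := Topological.on unit_interval.

Fact in_unit_interval (t : R) :
  0 <= t <= 1 -> t \in (`[0, 1]%classic : set R).
Proof. by move=> t01; rewrite inE /= in_itv. Qed.

Fact unit_interval0_subproof : 0 <= (0 : R) <= 1.
Proof. by rewrite lexx ler01. Qed.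

Fact unit_interval1_subproof : 0 <= (1 : R) <= 1.
Proof. by rewrite lexx ler01. Qed.

Definition unit_interval0 : unit_interval :=
  exist _ 0 (in_unit_interval unit_interval0_subproof).
Definition unit_interval1 : unit_interval :=
  exist _ 1 (in_unit_interval unit_interval1_subproof).

Fact unit_interval0_neq1 : unit_interval0 != unit_interval1.
Proof. by rewrite -val_eqE /= eq_sym oner_eq0. Qed.

HB.instance Definition _ :=
  isBiPointed.Build unit_interval unit_interval0_neq1.

Fact reverse_subproof (t : unit_interval) : 0 <= 1 - val t <= 1.
Proof.
by have := set_valP t; rewrite /= in_itv /= subr_ge0 gerBl andbC.
Qed.

Definition reverse (t : unit_interval) : unit_interval :=
  exist _ (1 - val t) (in_unit_interval (reverse_subproof t)).

End UnitInterval.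

Section SimplyConnected.
Context (R : realType) (X : topologicalType).

(* Homotopy relative to the endpoints. *)
Definition path_homotopic (x y : X)
    (p q : {path unit_interval R from x to y in X}) : Prop :=
  exists H : unit_interval R * unit_interval R -> X,
    [/\ continuous H,
        forall t, H (zero, t) = p t,
        forall t, H (one, t) = q t,
        forall s, H (s, zero) = x &
        forall s, H (s, one) = y].

Definition simply_connected : Prop :=
  [/\ exists x : X, True,
      forall x y : X, exists p : {path unit_interval R from x to y in X}, True
    & forall (x : X) (p : {path unit_interval R from x to x}),
        path_homotopic p (cst x)].

End SimplyConnected.

Section CW2.
Context (R : realType) (T : finType) (e : rel T).

(* Each pair of adjacent vertices is listed once, oriented along an arbitrary
   total order of the vertices. *)
Definition edge : finType :=
  {a : T * T | e a.1 a.2 && (enum_rank a.1 < enum_rank a.2)%N}.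

Definition realization : topologicalType :=
  attach (X := discrete_topology T) (D := unit_interval R)
    (B := fun _ : edge => bool)
    (fun _ b => if b then one else zero)
    (fun a b => if b then (val a).2 else (val a).1).

Definition realization_vertex (x : T) : realization :=
  attach_base _ _ (x : discrete_topology T).

Definition realization_edge (a : edge) (s : unit_interval R) : realization :=
  attach_cell _ _ a s.

(* The point at parameter s of the edge from x to y, for adjacent x and y
   (the last branch is a dummy value). *)
Definition segment (x y : T) (s : unit_interval R) : realization :=
  if insub (x, y) is Some a then realization_edge a s
  else if insub (y, x) is Some a then realization_edge a (reverse s)
  else realization_vertex x.

(* Cycles that differ by a rotation or a reflection bound the same cell.  The
   last two conditions select one representative in each class: it starts at
   its least vertex, and its second vertex is less than its last one. *)
Definition is_face (c : seq T) : bool :=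
  [&& (size c == 3%N) || (size c == 4%N), ucycleb e c &
      if c is x :: p then
        all (fun y => enum_rank x < enum_rank y)%N p &&
        (enum_rank (head x p) < enum_rank (last x p))%N
      else false].

Definition faces : choiceType := {c : seq T | is_face c}.

Definition disc : set (R * R) := [set p | p.1 ^+ 2 + p.2 ^+ 2 <= 1].

Fact circle_subproof (t : R) : (cos t, sin t) \in disc.
Proof. by rewrite inE /disc /= cos2Dsin2. Qed.

Definition circle (t : R) : disc := exist _ (cos t, sin t) (circle_subproof t).

(* The circle is divided into as many equal arcs as the cycle c has vertices,
   and the k-th arc is mapped onto the edge joining the k-th vertex of c to its
   successor. *)
Definition CW2 : topologicalType :=
  attach (X := realization) (D := disc : Type)
    (B := fun c : faces => ('I_(size (val c)) * unit_interval R)%type)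
    (fun c b => circle (2 * pi * ((b.1%:R + val b.2) / (size (val c))%:R)))
    (fun c b => segment (tnth (in_tuple (val c)) b.1)
                        (tnth (in_tuple (val c)) (ordS b.1)) b.2).

End CW2.

(* Main.v *)
Require Import Defs.
From HB Require Import structures.
From mathcomp Require Import all_boot all_order all_algebra.
From mathcomp Require Import all_classical all_reals all_analysis homotopy.
From mathcomp Require Import ring lra zify.
From Stdlib Require Import Relation_Operators.

(** The idea is to find, for every point [q] of the complex, a path [g q] from
    a base point [z0] to [q], in such a way that every path [p] from [q] to [q']
    is forced by its ends: [g q] followed by [p] is homotopic to [g q'].  For a
    loop [p] at [q] this says that [p] is null-homotopic
    ([system_simply_connected]), and [g] also connects all points.

    Such a family of paths is built one dimension at a time.  If a space [X] has
    one, and if moreover the paths chosen at the boundary points of each cell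
    are carried to each other across the cell, then the space obtained from [X]
    by attaching the cells has one too ([attach_system]).  Indeed the condition
    is local along the path [p], which may therefore be assumed to stay either
    in a collar of [X], from where a straight-line homotopy pushes it into [X],
    or in the interior of a single cell, which is contractible.  Thus it
    suffices to choose paths [g v] to the vertices so that [g u] followed by the
    edge from [u] to [v] is homotopic to [g v].

    The homotopy classes of paths from [z0] to the vertices form a local system
    of sets on the graph: an edge acts by prolonging the paths.  What is needed
    is that two walks with the same ends act in the same way.  Closed walks of
    length at most 4 act trivially ([monodromy_small]), because backtracks
    cancel and triangles and squares bound a disc.  That this implies the same
    for all closed walks ([monodromy_unique]) is where magnitude homology comes
    in.  Argue by induction on the length [n > 4] of the closed walk, and cut it
    into two walks [A] and [B] from [x] to [z], where the length [k] of [A] is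
    that of [B] or one more, so that [k > 2].  Suppose that [A] and [B] act
    differently.  By induction, for each [y] different from [x] and [z] with
    d(x, y) + d(y, z) = k, all the walks of length [k] from [x] to [z] through
    [y] act in the same way; let w(x, y, z) be 1 if they act like [A], and 0
    otherwise.  Then [w] vanishes on boundaries ([weight_boundary]): among the
    two inner faces of a generator (x, y, y', z), if both are nonzero then w
    agrees on them, by looking at a walk through [y] and [y'], and if only one
    is nonzero then walks through its middle vertex can be shortened, hence act
    like [B] by induction, and w vanishes on that face.  But the first step
    [a] of [A] gives a generator (x, a, z) with w(x, a, z) = 1, and this
    generator is a cycle, at least after subtracting the one given by [B] if [B]
    has length [k] too.  So MH_{2,k} is not zero, a contradiction.  *)

Set Implicit Arguments.
Unset Strict Implicit.
Unset Printing Implicit Defensive.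

Import Order.TTheory GRing.Theory Num.Theory.
Import numFieldNormedType.Exports.
Local Open Scope classical_set_scope.
Local Open Scope quotient_scope.
Local Open Scope ring_scope.

(** * Continuity *)

Section Continuity.
Context {T U : topologicalType}.

Lemma cont_comp (W : topologicalType) (f : T -> U) (g : U -> W) :
  continuous g -> continuous f -> continuous (fun x => g (f x)).
Proof. by move=> cg cf x; apply: continuous_comp; [exact: cf|exact: cg]. Qed.

Lemma cont_pair (W : topologicalType) (f : T -> U) (g : T -> W) :
  continuous f -> continuous g -> continuous (fun x => (f x, g x)).
Proof. by move=> cf cg x; apply: cvg_pair; [exact: cf|exact: cg]. Qed.

Lemma cont_fst (W : topologicalType) (f : T -> U * W) : continuous f ->
  continuous (fun x => (f x).1).
Proof. by move=> cf x; apply: (@cvg_comp _ _ _ f fst _ (nbhs (f x)));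
  [exact: cf|exact: cvg_fst]. Qed.

Lemma cont_snd (W : topologicalType) (f : T -> U * W) : continuous f ->
  continuous (fun x => (f x).2).
Proof. by move=> cf x; apply: (@cvg_comp _ _ _ f snd _ (nbhs (f x)));
  [exact: cf|exact: cvg_snd]. Qed.

Lemma cont_id : continuous (fun x : T => x).
Proof. by move=> x. Qed.

Lemma cont_cst (c : U) : continuous (fun _ : T => c).
Proof. exact: cst_continuous. Qed.

End Continuity.

Section RealContinuity.
Context {R : realType} {T : topologicalType}.

Lemma cont_add (V : normedModType R) (f g : T -> V) :
  continuous f -> continuous g -> continuous (fun x => f x + g x).
Proof. by move=> cf cg x; apply: cvgD; [exact: cf|exact: cg]. Qed.

Lemma cont_opp (V : normedModType R) (f : T -> V) :
  continuous f -> continuous (fun x => - f x).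
Proof. by move=> cf x; apply: cvgN; exact: cf. Qed.

Lemma cont_scale (V : normedModType R) (k : T -> R) (f : T -> V) :
  continuous k -> continuous f -> continuous (fun x => k x *: f x).
Proof. by move=> cf cg x; apply: cvgZ; [exact: cf|exact: cg]. Qed.

Lemma cont_mul (f g : T -> R) :
  continuous f -> continuous g -> continuous (fun x => f x * g x).
Proof. by move=> cf cg x; apply: cvgM; [exact: cf|exact: cg]. Qed.

Lemma cont_sqr (f : T -> R) : continuous f -> continuous (fun x => f x ^+ 2).
Proof.
move=> cf; rewrite (_ : (fun x => _) = fun x => f x * f x);
  first exact: cont_mul.
by apply/funext => x; rewrite expr2.
Qed.

Lemma cont_inv (f : T -> R) :
  (forall x, f x != 0) -> continuous f -> continuous (fun x => (f x)^-1).
Proof. by move=> f0 cf x; apply: cvgV; [exact: f0|exact: cf]. Qed.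

Lemma cont_max (f g : T -> R) :
  continuous f -> continuous g -> continuous (fun x => Num.max (f x) (g x)).
Proof. by move=> cf cg x; apply: continuous_max; [exact: cf|exact: cg]. Qed.

Lemma cont_min (f g : T -> R) :
  continuous f -> continuous g -> continuous (fun x => Num.min (f x) (g x)).
Proof. by move=> cf cg x; apply: continuous_min; [exact: cf|exact: cg]. Qed.

Lemma closed_le (f g : T -> R) : continuous f -> continuous g ->
  closed [set x | f x <= g x].
Proof.
move=> cf cg; have -> : [set x | f x <= g x] = (fun x => g x - f x) @^-1`
  [set y | 0 <= y].
  by apply/seteqP; split => x /=; rewrite subr_ge0.
have /continuous_closedP := cont_add cg (cont_opp cf); apply.
exact: closed_ge.
Qed.

Lemma cont_paste (U : topologicalType) (h k : T -> R) (f g : T -> U) :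
  continuous h -> continuous k -> continuous f -> continuous g ->
  (forall x, h x = k x -> f x = g x) ->
  continuous (fun x => if h x <= k x then f x else g x).
Proof.
move=> ch ck cf cg fg; apply/continuous_subspace_setT.
have -> : [set: T] = [set x | h x <= k x] `|` [set x | k x <= h x].
  by apply/esym/seteqP; split => // x _ /=; apply/orP; exact: le_total.
apply: withinU_continuous; [exact: closed_le|exact: closed_le| |].
- apply: (@subspace_eq_continuous _ _ _ f); last exact: continuous_subspaceT.
  by move=> x /set_mem /= hk; rewrite /from_subspace hk.
- apply: (@subspace_eq_continuous _ _ _ g); last exact: continuous_subspaceT.
  move=> x /set_mem /= kh; rewrite /from_subspace; case: ifP => // hk.
  by apply/esym/fg/le_anti; rewrite hk kh.
Qed.

End RealContinuity.

Section Subtype.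
Context {T U : topologicalType} (A : set U).

Lemma cont_subtype (f : T -> set_type A) :
  continuous (fun x => set_val (f x)) -> continuous f.
Proof. exact: continuous_comp_initial. Qed.

Lemma cont_set_val : continuous (set_val : set_type A -> U).
Proof. exact: initial_continuous. Qed.

End Subtype.

Section Clamp.
Context {R : realType}.
Implicit Types a b s : R.

(** The retraction of the line onto a segment, thanks to which paths and
    homotopies can be total functions of real parameters. *)
Definition clamp a b s : R := Num.max a (Num.min b s).

Lemma clamp_id a b s : a <= s -> s <= b -> clamp a b s = s.
Proof. by move=> as_ sb; rewrite /clamp min_r // max_r. Qed.

Lemma clamp_ge a b s : a <= clamp a b s.
Proof. by rewrite /clamp le_max lexx. Qed.

Lemma clamp_le a b s : a <= b -> clamp a b s <= b.
Proof. by move=> ab; rewrite /clamp ge_max ab ge_min lexx. Qed.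

Lemma clamp_hi a b s : a <= b -> b <= s -> clamp a b s = b.
Proof. by move=> ab bs; rewrite /clamp min_l // max_r. Qed.

Lemma clamp_lo a b s : s <= a -> clamp a b s = a.
Proof. by move=> sa; rewrite /clamp max_l // ge_min sa orbT. Qed.

Lemma cont_clamp (T : topologicalType) (f : T -> R) a b :
  continuous f -> continuous (fun x => clamp a b (f x)).
Proof.
move=> cf; apply: cont_max; first exact: cont_cst.
by apply: cont_min => //; exact: cont_cst.
Qed.

End Clamp.

(** The rule is chosen from the syntax of the function: unification up to
    conversion would see through the operations of the reals. *)
Ltac cont := repeat lazymatch goal with
  | |- forall _, continuous_at _ ?F =>
    lazymatch F with
    | fun x => x => exact: cont_id
    | fun _ => ?c => exact: cont_cst
    | fun x => (@?f x, @?g x) => apply: (cont_pair (f := f) (g := g))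
    | fun x => @?f x + @?g x => apply: (cont_add (f := f) (g := g))
    | fun x => - @?f x => apply: (cont_opp (f := f))
    | fun x => @?f x * @?g x => apply: (cont_mul (f := f) (g := g))
    | fun x => @?f x ^+ 2 => apply: (cont_sqr (f := f))
    | fun x => @?f x *: @?g x => apply: (cont_scale (k := f) (f := g))
    | fun x => Num.max (@?f x) (@?g x) => apply: (cont_max (f := f) (g := g))
    | fun x => Num.min (@?f x) (@?g x) => apply: (cont_min (f := f) (g := g))
    | fun x => clamp ?a ?b (@?f x) =>
      apply: (cont_clamp (f := f) (a := a) (b := b))
    | fun x => (@?f x).1 => apply: (cont_fst (f := f))
    | fun x => (@?f x).2 => apply: (cont_snd (f := f))
    | fun x => ?h (@?f x) =>
      match goal with
      | ch : forall _, continuous_at _ h |- _ => apply: (cont_comp (f := f) ch)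
      end
    | @GRing.mul _ ?a => apply: (cont_mul (f := fun=> a) (g := fun x => x))
    | clamp ?a ?b => exact: (cont_clamp cont_id)
    | fst => exact: (cont_fst cont_id)
    | snd => exact: (cont_snd cont_id)
    | _ => assumption
    end
  end.

(** * Induction on a segment *)

Section Induction.
Context {R : realType}.
Implicit Types a b s : R.

(** The supremum of the points reached from [a] is itself reached, and the
    process continues beyond it unless it is [b]. *)
Lemma real_induction (P : R -> R -> Prop) a b : a <= b ->
  (forall x y z, a <= x -> x <= y -> y <= z -> z <= b -> P x y -> P y z ->
    P x z) ->
  (forall s, a <= s -> s <= b -> exists2 e, 0 < e &
     forall x y, a <= x -> x <= y -> y <= b -> s - e < x -> y < s + e -> P x y)
       ->
  P a b.
Proof.
move=> ab Ptr Ploc.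
pose A := [set s | a <= s /\ s <= b /\ P a s].
have Aa : A a.
  split=> //; split=> //; have [e e0 Pe] := Ploc a (lexx a) ab.
  by apply: Pe => //; lra.
have supA : has_sup A by split; [exists a|exists b => s [_ []]].
have as_ : a <= sup A by apply: (ub_le_sup (proj2 supA)).
have sb : sup A <= b by apply: sup_le_ub => [|s [_ []] //]; exists a.
have [e e0 Pe] := Ploc _ as_ sb.
have [x [ax [xb Pax]] xs] := sup_adherent e0 supA.
have xS : x <= sup A by apply: (ub_le_sup (proj2 supA)).
pose y := Num.min b (sup A + e / 2).
have Sy : sup A <= y by rewrite /y le_min sb /=; lra.
have yb : y <= b by rewrite /y ge_min lexx.
have ye : y <= sup A + e / 2 by rewrite /y ge_min lexx orbT.
have Pay : P a y.
  apply: (Ptr a x y) => //; first lra.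
  by apply: Pe => //; lra.
have yS : y <= sup A by apply: (ub_le_sup (proj2 supA)); split; [lra|split].
suff <- : y = b by [].
move: yS; rewrite /y; case: (leP b (sup A + e / 2)) => // _; lra.
Qed.

(** Subdivision of a segment: a property of subintervals that is inherited
    by the union of two adjacent ones has only to be checked locally. *)
Lemma nbhs_induction (P : R -> R -> Prop) a b : a <= b ->
  (forall x y z, a <= x -> x <= y -> y <= z -> z <= b -> P x y -> P y z ->
    P x z) ->
  (forall s, a <= s -> s <= b -> exists2 N, nbhs s N &
     forall x y, a <= x -> x <= y -> y <= b ->
       (forall z, x <= z -> z <= y -> N z) -> P x y) ->
  P a b.
Proof.
move=> ab Ptr Ploc; apply: real_induction => // s as_ sb.
have [N /nbhs_ballP[e /= e0 eN] NP] := Ploc s as_ sb.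
exists e => // x y ax xy yb sx ys; apply: NP => // z xz zy.
by apply: eN; rewrite /ball /= ltr_distlC; apply/andP; split; lra.
Qed.

End Induction.

(** * The unit interval *)

Lemma compact_subtype_closed (R : realType) (V : normedModType R) (A : set V)
    (K : set (set_type A)) : compact K -> closed K.
Proof.
move=> cK; have cv := @cont_set_val V A.
have -> : K = (set_val : set_type A -> V) @^-1` (set_val @` K).
  apply/seteqP; split=> [x Kx|x [y Ky yx]]; first by exists x.
  by move: yx; rewrite set_valE => /val_inj <-.
move/continuous_closedP: cv; apply; apply: compact_closed;
  first exact: norm_hausdorff.
by apply: continuous_compact;
  [exact/continuous_subspaceT/cont_set_val|exact: cK].
Qed.

Section Interval.
Context {R : realType}.

Fact to_interval_subproof (s : R) : 0 <= clamp 0 1 s <= 1.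
Proof. by rewrite clamp_ge clamp_le. Qed.

Definition to_interval (s : R) : unit_interval R :=
  exist _ (clamp 0 1 s) (in_unit_interval (to_interval_subproof s)).

Lemma cont_to_interval : continuous to_interval.
Proof.
apply: cont_subtype; rewrite /= (_ : (fun s => _) = clamp 0 1).
  by move=> s; apply: (cont_clamp (f := fun s => s)); exact: cont_id.
by apply/funext => s; rewrite set_valE.
Qed.

Lemma to_intervalK (t : unit_interval R) : to_interval (set_val t) = t.
Proof.
apply/val_inj; rewrite /= set_valE; have := set_valP t.
by rewrite /= in_itv /= => /andP[t0 t1]; rewrite clamp_id.
Qed.

Lemma to_interval0 : to_interval 0 = zero.
Proof. by apply/val_inj => /=; rewrite clamp_id. Qed.

Lemma to_interval1 : to_interval 1 = one.
Proof. by apply/val_inj => /=; rewrite clamp_id. Qed.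

Lemma interval_compact : compact [set: unit_interval R].
Proof.
have -> : [set: unit_interval R] = to_interval @` `[0, 1]%classic.
  apply/seteqP; split=> // t _; exists (set_val t); last exact: to_intervalK.
  exact: set_valP.
apply: continuous_compact; last exact: segment_compact.
by apply: continuous_subspaceT; exact: cont_to_interval.
Qed.

Lemma interval_itv (t : unit_interval R) : 0 <= (set_val t : R) <= 1.
Proof. by have := set_valP t; rewrite /= in_itv. Qed.

Lemma to_interval_reverse (s : R) :
  to_interval (1 - s) = reverse (to_interval s).
Proof.
apply/val_inj => /=.
have [s1|s1] := leP s 1; last by rewrite (@clamp_lo _ 0) ?clamp_hi ?subrr //;
  lra.
have [s0|s0] := leP 0 s; last by rewrite clamp_hi ?clamp_lo ?subr0 //; lra.
by rewrite !clamp_id //; lra.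
Qed.

Lemma interval_val0 : set_val (zero : unit_interval R) = 0 :> R.
Proof. by rewrite set_valE. Qed.

Lemma interval_val1 : set_val (one : unit_interval R) = 1 :> R.
Proof. by rewrite set_valE. Qed.

Lemma interval_eq0 (t : unit_interval R) : val t <= 0 -> t = zero.
Proof.
move=> t0; apply/val_inj/le_anti; rewrite t0 /=.
by have := interval_itv t; rewrite set_valE => /andP[].
Qed.

Lemma interval_eq1 (t : unit_interval R) : 1 <= val t -> t = one.
Proof.
move=> t0; apply/val_inj/le_anti; rewrite t0 andbT /=.
by have := interval_itv t; rewrite set_valE => /andP[].
Qed.

Lemma reverseK : involutive (@reverse R).
Proof. by move=> s; apply/val_inj; rewrite /= opprB addrC subrK. Qed.

Lemma reverse_zero : reverse zero = one :> unit_interval R.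
Proof. by apply/val_inj; rewrite /= subr0. Qed.

Lemma reverse_one : reverse one = zero :> unit_interval R.
Proof. by rewrite -reverse_zero reverseK. Qed.

Lemma cont_reverse : continuous (@reverse R).
Proof.
apply: cont_subtype; rewrite set_valE /=.
have cv := @cont_set_val R `[0, 1]%classic.
apply: cont_add; first exact: cont_cst.
by apply: cont_opp; exact: cv.
Qed.

End Interval.

(** * Squares, homotopies and transport *)

Section Squares.
Context (R : realType) (Z : topologicalType) (z0 : Z).
Implicit Types (a b c : R) (al be de top : R -> Z).

(** A map of the rectangle [a, b] x [0, 1] whose bottom is constant.  It says
    that [al] followed by [top] is homotopic to [be], but no path has to be
    concatenated, so that squares paste without reparametrization. *)
Definition square a b top al be := exists H : R * R -> Z,
  [/\ continuous H,
      forall t, 0 <= t -> t <= 1 -> H (a, t) = al t,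
      forall t, 0 <= t -> t <= 1 -> H (b, t) = be t,
      forall s, a <= s -> s <= b -> H (s, 0) = z0 &
      forall s, a <= s -> s <= b -> H (s, 1) = top s].

Lemma square_cst a b al z : continuous al -> al 0 = z0 -> al 1 = z ->
  square a b (fun=> z) al al.
Proof.
move=> cal al0 al1; exists (fun p => al p.2); split => //.
by cont.
Qed.

Lemma square_cat a b c top al be de : a <= b -> b <= c ->
  square a b top al be -> square b c top be de -> square a c top al de.
Proof.
move=> ab bc [H [cH Ha Hb H0 H1]] [K [cK Ka Kb K0 K1]].
exists (fun p => if p.1 <= b then H (p.1, clamp 0 1 p.2) else K
  (p.1, clamp 0 1 p.2)).
split => [|t t0 t1|t t0 t1|s as_ sc|s as_ sc] /=.
- apply: cont_paste; cont; by move=> p ->;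
    rewrite Hb ?Ka // ?clamp_ge ?clamp_le.
- by rewrite ab clamp_id // Ha.
- rewrite clamp_id //; case: ifP => cb; last exact: Kb.
  have <- : b = c by apply: le_anti; rewrite bc cb.
  by rewrite Hb // -Ka // (_ : b = c) ?Kb //; apply: le_anti; rewrite bc cb.
- by rewrite clamp_id //; case: ifPn => [sb|];
    [exact: H0|rewrite -ltNge => /ltW bs; exact: K0].
- by rewrite clamp_id //; case: ifPn => [sb|];
    [exact: H1|rewrite -ltNge => /ltW bs; exact: K1].
Qed.

Lemma square_reparam a b a' b' (h : R -> R) top al be : continuous h ->
  h a' = a -> h b' = b ->
  (forall s, a' <= s -> s <= b' -> a <= h s /\ h s <= b) ->
  square a b top al be -> square a' b' (fun s => top (h s)) al be.
Proof.
move=> ch ha hb hab [H [cH Ha Hb H0 H1]].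
exists (fun p => H (h p.1, p.2)).
split => [|t t0 t1|t t0 t1|s as_ sc|s as_ sc] /=.
- by cont.
- by rewrite ha Ha.
- by rewrite hb Hb.
- by case: (hab _ as_ sc) => ? ?; rewrite H0.
- by case: (hab _ as_ sc) => ? ?; rewrite H1.
Qed.

Lemma square_flip a b a' b' (h : R -> R) top al be : continuous h ->
  h a' = b -> h b' = a ->
  (forall s, a' <= s -> s <= b' -> a <= h s /\ h s <= b) ->
  square a b top al be -> square a' b' (fun s => top (h s)) be al.
Proof.
move=> ch ha hb hab [H [cH Ha Hb H0 H1]].
exists (fun p => H (h p.1, p.2)).
split => [|t t0 t1|t t0 t1|s as_ sc|s as_ sc] /=.
- by cont.
- by rewrite ha Hb.
- by rewrite hb Ha.
- by case: (hab _ as_ sc) => ? ?; rewrite H0.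
- by case: (hab _ as_ sc) => ? ?; rewrite H1.
Qed.

Lemma eq_square a b top top' al al' be be' :
  (forall s, a <= s -> s <= b -> top s = top' s) ->
  (forall t, 0 <= t -> t <= 1 -> al t = al' t) ->
  (forall t, 0 <= t -> t <= 1 -> be t = be' t) ->
  square a b top al be -> square a b top' al' be'.
Proof.
move=> et ea eb [H [cH Ha Hb H0 H1]]; exists H; split => // s s0 s1.
- by rewrite -ea // Ha.
- by rewrite -eb // Hb.
- by rewrite -et // H1.
Qed.

Definition path_cat (al g : R -> Z) (t : R) : Z :=
  if 2 * t <= 1 then al (2 * t) else g (2 * t - 1).

Lemma path_cat_cont al g : continuous al -> continuous g -> al 1 = g 0 ->
  continuous (path_cat al g).
Proof.
move=> cal cg alg; apply: cont_paste; cont.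
by move=> x ->; rewrite subrr.
Qed.

Lemma path_cat0 al g : path_cat al g 0 = al 0.
Proof. by rewrite /path_cat mulr0 ler01. Qed.

Lemma path_cat1 al g : path_cat al g 1 = g 1.
Proof.
rewrite /path_cat mulr1 ifF; last by apply/negbTE; rewrite -ltNge; lra.
by congr g; lra.
Qed.

(** The given square fills the lower half of the new one and [G] the upper
    half, so that the sides are prolonged by those of [G]. *)
Lemma square_stack a b mid top al be (G : R * R -> Z) : a <= b ->
  square a b mid al be -> continuous G ->
  (forall s, a <= s -> s <= b -> G (s, 0) = mid s) ->
  (forall s, a <= s -> s <= b -> G (s, 1) = top s) ->
  square a b top (path_cat al (fun t => G (a, t)))
    (path_cat be (fun t => G (b, t))).
Proof.
move=> ab [H [cH Ha Hb H0 H1]] cG G0 G1.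
have cl s : a <= clamp a b s /\ clamp a b s <= b by rewrite clamp_ge clamp_le.
exists (fun p => if 2 * p.2 <= 1 then H (clamp a b p.1, 2 * p.2)
                 else G (clamp a b p.1, 2 * p.2 - 1)).
split => [|t t0 t1|t t0 t1|s as_ sc|s as_ sc] /=.
- apply: cont_paste; cont.
  move=> p ->; rewrite subrr; have [? ?] := cl p.1.
  by rewrite H1 // G0.
- rewrite /path_cat clamp_id //; case: ifP => t2 //; rewrite Ha //; lra.
- rewrite /path_cat clamp_id //; case: ifP => t2 //; rewrite Hb //; lra.
- by rewrite mulr0 ler01 clamp_id // H0.
- rewrite mulr1 ifF; last by apply/negbTE; rewrite -ltNge; lra.
  by rewrite clamp_id // (_ : 2 - 1 = 1) ?G1 //; lra.
Qed.

(** If [K] runs through [al] on [0, 1] and then through [g] on [1, 2], the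
    vertical path at abscissa [s] is [K] on [0, 1 + s]. *)
Lemma square_extend al g : continuous al -> continuous g -> al 0 = z0 ->
  al 1 = g 0 -> square 0 1 g al (path_cat al g).
Proof.
move=> cal cg al0 alg.
pose K t := if t <= 1 then al t else g (t - 1).
have cK : continuous K.
  apply: cont_paste; cont.
  by move=> x ->; rewrite subrr.
exists (fun p => K (p.2 * (1 + p.1))).
split => [|t t0 t1|t t0 t1|s as_ sc|s as_ sc] /=.
- by cont.
- by rewrite addr0 mulr1 /K t1.
- by rewrite /K /path_cat (_ : t * (1 + 1) = 2 * t) //; lra.
- by rewrite mul0r /K ler01.
- rewrite mul1r /K; case: ifP => s1; last by congr g; lra.
  by rewrite (_ : s = 0) ?addr0 //; lra.
Qed.

(** A square with constant top is a homotopy relative to the ends. *)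
Definition homotopic al be := square 0 1 (fun=> al 1) al be.

Lemma homotopic_path_cat al g : continuous al -> al 0 = z0 ->
  (forall t, g t = al 1) -> homotopic al (path_cat al g).
Proof.
move=> cal al0 ge; have -> : g = fun=> al 1 by apply/funext.
by apply: square_extend => //; exact: cont_cst.
Qed.

Section Transport.
Context {V : normedModType R} (F : V -> Z).
Implicit Types (u v w : V).

(** Only the ends of the path along which [al] is carried are recorded.  As
    [V] is convex nothing is lost, and these relations compose. *)
Definition transport u v al be := exists w : R -> V,
  [/\ continuous w, w 0 = u, w 1 = v & square 0 1 (fun s => F (w s)) al be].

Lemma transport_sym u v al be : transport u v al be -> transport v u be al.
Proof.
case=> w [cw w0 w1 sq]; exists (fun s => w (1 - s)); split.
- by cont.
- by rewrite subr0.
- by rewrite subrr.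
- by apply: (square_flip _ _ _ _ sq) => [||| s s0 s1]; cont; try split; lra.
Qed.

Lemma transport_trans u v w al be de :
  transport u v al be -> transport v w be de -> transport u w al de.
Proof.
case=> p [cp p0 p1 sq] [q [cq q0 q1 sq']].
exists (fun s => if 2 * s <= 1 then p (2 * s) else q (2 * s - 1)); split.
- apply: cont_paste; cont.
  by move=> x ->; rewrite subrr p1 q0.
- by rewrite mulr0 ler01.
- rewrite mulr1 ifF; last by apply/negbTE; rewrite -ltNge; lra.
  by rewrite (_ : 2 - 1 = 1) //; lra.
- apply: (@square_cat 0 (2^-1) 1 _ _ be); [lra|lra| |].
  + have : square 0 2^-1 (fun s => F (p (2 * s))) al be.
      by apply: (square_reparam _ _ _ _ sq) => [||| s s0 s1]; cont; try split;
        lra.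
    by apply: eq_square => // s s0 s1; rewrite ifT //; lra.
  + have : square 2^-1 1 (fun s => F (q (2 * s - 1))) be de.
      by apply: (square_reparam _ _ _ _ sq') => [||| s s0 s1]; cont; try split;
        lra.
    apply: eq_square => // s s0 s1; case: ifP => // s2.
    have -> : 2 * s = 1 by lra.
    by rewrite subrr p1 q0.
Qed.

Lemma homotopic_transport u al be : F u = al 1 -> homotopic al be ->
  transport u u al be.
Proof.
by move=> Fu h; exists (fun=> u); split => //; [exact: cont_cst|rewrite Fu].
Qed.

End Transport.

(** Homotopy thus inherits symmetry and transitivity from transport. *)
Lemma homotopic_cst_transport (V : normedModType R) (u : V) al be z :
  z = al 1 ->
  homotopic al be <-> transport (fun _ : V => z) u u al be.
Proof.
move=> ->; split; first exact: homotopic_transport.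
by case=> w [].
Qed.

Definition based_path al := continuous al /\ al 0 = z0.

Lemma homotopic_end al be : homotopic al be -> be 1 = al 1.
Proof. by case=> H [_ _ Hb _ H1]; rewrite -Hb // ?H1 // ler01. Qed.

Lemma homotopic_sym al be : homotopic al be -> homotopic be al.
Proof.
move=> h; have e := homotopic_end h; move: h.
rewrite (@homotopic_cst_transport R^o 0 _ _ (al 1)) //.
by rewrite (@homotopic_cst_transport R^o 0 _ _ (al 1)) //; exact: transport_sym.
Qed.

Lemma homotopic_trans al be de :
  homotopic al be -> homotopic be de -> homotopic al de.
Proof.
move=> h; have e := homotopic_end h; move: h.
rewrite !(@homotopic_cst_transport R^o 0 _ _ (al 1)) //.
exact: transport_trans.
Qed.

Lemma homotopic_refl al : based_path al -> homotopic al al.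
Proof. by case=> cal al0; apply: square_cst. Qed.

Lemma transport_end (V : normedModType R) (F : V -> Z) u v al be :
  transport F u v al be -> al 1 = F u /\ be 1 = F v.
Proof.
case=> w [_ <- <- [H [_ Ha Hb _ H1]]].
by split; [rewrite -Ha|rewrite -Hb]; rewrite ?H1 ?ler01.
Qed.

(** The loop in [V] shrinks to its base point along straight lines.  Put on
    top of the square, this homotopy makes the top constant, and it prolongs
    both sides by constant paths only. *)
Lemma transport_loop (V : normedModType R) (F : V -> Z) u al be :
  continuous F -> based_path al -> based_path be ->
  transport F u u al be -> homotopic al be.
Proof.
move=> cF [cal al0] [cbe be0] tr; have [al1 be1] := transport_end tr.
case: tr => w [cw w0 w1 sq].
pose G (p : R * R) := F ((1 - p.2) *: w p.1 + p.2 *: u).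
have cG : continuous G by rewrite /G; cont.
have fixu t : (1 - t) *: u + t *: u = u.
  by rewrite -scalerDl subrK scale1r.
have hal : homotopic al (path_cat al (fun t => G (0, t))).
  by apply: homotopic_path_cat => // t; rewrite /G /= w0 fixu al1.
have hbe : homotopic be (path_cat be (fun t => G (1, t))).
  by apply: homotopic_path_cat => // t; rewrite /G /= w1 fixu be1.
apply: (homotopic_trans hal);
  apply/homotopic_sym/(homotopic_trans hbe)/homotopic_sym.
have e := homotopic_end hal.
apply: (square_stack (a := 0) (b := 1) _ sq cG) => [|s _ _|s _ _];
  rewrite /G /=.
- by [].
- by rewrite subr0 scale1r scale0r addr0.
- by rewrite subrr scale0r add0r scale1r e.
Qed.

Lemma transport_map (V V' : normedModType R) (F : V -> Z) (F' : V' -> Z)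
    (g : V -> V') u v al be :
  continuous g -> (forall x, F' (g x) = F x) ->
  transport F u v al be -> transport F' (g u) (g v) al be.
Proof.
move=> cg Fg [w [cw w0 w1 sq]]; exists (fun s => g (w s)).
split; [by apply: (cont_comp cg)|by rewrite w0|by rewrite w1|].
by apply: eq_square sq.
Qed.

End Squares.

(** * Compatible families of paths *)

Section PathSystem.
Context (R : realType) (Z : topologicalType) (z0 : Z).

(** Compatible paths from [z0] to all the points of [Y], seen in [Z]: the
    image in [Z] of a path of [Y] is determined up to homotopy by its ends. *)
Record path_system (Y : topologicalType) (f : Y -> Z) (g : Y -> R -> Z) :
  Prop :=
  PathSystem {
    system_cont : forall q, continuous (g q);
    system0 : forall q, g q 0 = z0;
    system1 : forall q, g q 1 = f q;
    system_square : forall (p : R -> Y) a b, continuous p -> a <= b ->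
      square z0 a b (fun s => f (p s)) (g (p a)) (g (p b)) }.

Section SimplyConnected.
Context (g : Z -> R -> Z) (sg : path_system id g).

Lemma system_connected (x y : Z) :
  exists p : {path unit_interval R from x to y in Z}, True.
Proof.
pose q : R -> Z := path_cat (fun t => g x (1 - t)) (g y).
have cx := @system_cont _ _ _ sg x; have cy := @system_cont _ _ _ sg y.
have cq : continuous q.
  apply: path_cat_cont => //; first by cont.
  by rewrite subrr !(system0 sg).
pose p := fun t : unit_interval R => q (set_val t).
have cp : continuous p by apply: (cont_comp cq); exact: cont_set_val.
have p0 : p zero = x by rewrite /p set_valE /= /q path_cat0 subr0 (system1 sg).
have p1 : p one = y by rewrite /p set_valE /= /q path_cat1 (system1 sg).
by exists (mk_path cp p0 p1).
Qed.

(** The path [p] is pushed across the square onto the path that goes down the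
    left side, along the bottom and up the right side.  As both sides are
    [g x], this is [g x] backwards, then forwards, and it shrinks to [x]. *)
Lemma loop_square_contract (x : Z) (p : R -> Z) :
  square z0 0 1 p (g x) (g x) ->
  exists H : R * R -> Z, [/\ continuous H,
    forall t, 0 <= t -> t <= 1 -> H (0, t) = p t,
    forall t, 0 <= t -> t <= 1 -> H (1, t) = x,
    forall s, 0 <= s -> s <= 1 -> H (s, 0) = x &
    forall s, 0 <= s -> s <= 1 -> H (s, 1) = x].
Proof.
move=> [H [cH H0 H1 Hb Ht]].
have cx := @system_cont _ _ _ sg x; have gx1 := system1 sg x;
  have gx0 := system0 sg x.
(* The point (X s, T s) goes down the left side, then along the bottom, then
   up the right side, each in a third of the time. *)
pose X (s : R) := clamp 0 1 (3 * s - 1).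
pose T (s : R) := clamp 0 1 (Num.max (1 - 3 * s) (3 * s - 2)).
have cX : continuous X by rewrite /X; cont.
have cT : continuous T by rewrite /T; cont.
have T0 s : 0 <= T s by exact: clamp_ge.
have T1 s : T s <= 1 by exact: clamp_le.
have X_0 : X 0 = 0 by rewrite /X clamp_lo //; lra.
have X_1 : X 1 = 1 by rewrite /X clamp_hi //; lra.
have T_0 : T 0 = 1 by rewrite /T clamp_hi // le_max; apply/orP; left; lra.
have T_1 : T 1 = 1 by rewrite /T clamp_hi // le_max; apply/orP; right; lra.
have HXT s : H (X s, T s) = g x (T s).
  have [s3|s3] := leP (3 * s) 1; first by rewrite /X clamp_lo ?H0 //; lra.
  have [s4|s4] := leP 2 (3 * s); first by rewrite /X clamp_hi ?H1 //; lra.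
  have -> : T s = 0 by rewrite /T clamp_lo // ge_max; apply/andP; split; lra.
  by rewrite Hb ?gx0 // ?clamp_ge ?clamp_le.
exists (fun q => if 2 * q.1 <= 1 then
    H ((1 - 2 * q.1) * q.2 + 2 * q.1 * X q.2, 1 - 2 * q.1 + 2 * q.1 * T q.2)
  else g x (Num.max (T q.2) (clamp 0 1 (2 * q.1 - 1)))).
split => [|t t0 t1|t t0 t1|s s0 s1|s s0 s1] /=.
- apply: cont_paste; cont => q ->.
  rewrite subrr mul0r !add0r !mul1r HXT clamp_id // max_l //.
- by rewrite mulr0 ler01 subr0 !mul0r mul1r !addr0 Ht.
- rewrite mulr1 ifF; last by apply/negbTE; rewrite -ltNge; lra.
  by rewrite clamp_hi // ?max_r ?gx1 //; lra.
- rewrite X_0 T_0 !mulr0 add0r mulr1 subrK; case: ifP => _;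
    first by rewrite H0 ?gx1.
  by rewrite max_l ?gx1 // clamp_le.
- rewrite X_1 T_1 !mulr1 subrK; case: ifP => _; first by rewrite H1 ?gx1.
  by rewrite max_l ?gx1 // clamp_le.
Qed.

Lemma system_simply_connected : simply_connected R Z.
Proof.
split; [by exists z0|exact: system_connected|move=> x p].
have cp : continuous (p : unit_interval R -> Z) by exact: cts_fun.
pose P s := p (to_interval s).
have cP : continuous P by apply: (cont_comp cp); exact: cont_to_interval.
have P0 : P 0 = x by rewrite /P to_interval0 path_zero.
have P1 : P 1 = x by rewrite /P to_interval1 path_one.
have := system_square sg cP ler01; rewrite /= P0 P1.
case/loop_square_contract => H [cH H0 H1 Ha Hb].
have cv := @cont_set_val R `[0, 1].
have v01 (t : unit_interval R) : 0 <= (set_val t : R) /\ (set_val t : R) <= 1.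
  by have := set_valP t; rewrite /= in_itv /= => /andP[].
exists (fun q => H (set_val q.1, set_val q.2)); split => [|t|t|s|s] /=.
- apply: (cont_comp cH); apply: cont_pair; apply: (cont_comp cv).
    exact: (cont_fst cont_id).
  exact: (cont_snd cont_id).
- rewrite set_valE /= H0; [|exact: (v01 t).1|exact: (v01 t).2].
  by rewrite /P (to_intervalK t).
- by rewrite set_valE /= H1 //; [exact: (v01 t).1|exact: (v01 t).2].
- by rewrite set_valE /= Ha //; [exact: (v01 s).1|exact: (v01 s).2].
- by rewrite set_valE /= Hb //; [exact: (v01 s).1|exact: (v01 s).2].
Qed.

End SimplyConnected.
End PathSystem.

(** * Attaching cells *)

Section Attach.
Context (X : topologicalType) (I : choiceType) (D : topologicalType).
Context (B : I -> Type) (bd : forall i, B i -> D) (phi : forall i, B i -> X).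
Hypothesis phi_bd : forall i (b b' : B i), bd b = bd b' -> phi b = phi b'.

Local Notation Y := (attach bd phi).
Local Notation sum := {o & summand X D o}.
Local Notation base := (attach_base bd phi).
Local Notation cell := (attach_cell bd phi).

Lemma cell_bd i (b : B i) : cell i (bd b) = base (phi b).
Proof. by apply/eqmodP; apply/asboolP; apply: rst_step; constructor. Qed.

(** A point of the glued space has one representative which is in [X] or in
    the interior of a cell.  As the gluing relation is only given by generators,
    this invariant is what tells points of the glued space apart. *)
Definition normal_cell i (d : D) : X + I * D :=
  if pselect (exists b : B i, bd b = d) is left ex
  then inl (phi (projT1 (cid ex))) else inr (i, d).

Definition normal_sum (u : sum) : X + I * D :=
  match u with
  | existT None x => inl x
  | existT (Some i) d => normal_cell i d
  end.

Lemma normal_cell_bd i (b : B i) : normal_cell i (bd b) = inl (phi b).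
Proof.
rewrite /normal_cell; case: pselect => [ex|]; last by case; exists b.
by case: (cid ex) => b' /= /phi_bd ->.
Qed.

Lemma normal_cell_int i (d : D) : ~ range (@bd i) d ->
  normal_cell i d = inr (i, d).
Proof.
move=> nd; rewrite /normal_cell; case: pselect => // -[b bdd].
by case: nd; exists b.
Qed.

Lemma normal_sum_glue u v : glue_rel bd phi u v -> normal_sum u = normal_sum v.
Proof.
move=> /asboolP; elim=> {u v} [u v [i b]||u v _ ->|u v w _ -> _ ->] //=.
exact: normal_cell_bd.
Qed.

Definition normal (q : Y) : X + I * D := normal_sum (repr q).

Lemma normal_pi (u : sum) :
  normal (\pi_({eq_quot (glue_equiv bd phi)}) u) = normal_sum u.
Proof.
apply: normal_sum_glue; have := reprK (\pi_({eq_quot (glue_equiv bd phi)}) u).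
by move/eqmodP.
Qed.

Lemma normal_base x : normal (base x) = inl x.
Proof. exact: normal_pi. Qed.

Lemma normal_cellE i d : normal (cell i d) = normal_cell i d.
Proof. exact: normal_pi. Qed.

Variant attach_spec : Y -> X + I * D -> Prop :=
  | AttachBase x : attach_spec (base x) (inl x)
  | AttachInt i d : ~ range (@bd i) d -> attach_spec (cell i d) (inr (i, d)).

Lemma attachP q : attach_spec q (normal q).
Proof.
elim/quotP: q => -[[i|] x] _.
  change (attach_spec (cell i x) (normal (cell i x))); rewrite normal_cellE.
  have [[b _ <-]|nx] := pselect (range (@bd i) x).
    by rewrite normal_cell_bd cell_bd; constructor.
  by rewrite normal_cell_int //; constructor.
by change (attach_spec (base x) (normal (base x))); rewrite normal_base;
  constructor.
Qed.

Lemma attach_openP (W : set Y) :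
  open W <-> open (base @^-1` W) /\ forall i, open (cell i @^-1` W).
Proof.
have -> : open W <-> open (\pi_({eq_quot (glue_equiv bd phi)}) @^-1` W) by [].
rewrite sigT_openP; split=> [oW|[oX oD] [i|]].
- by split=> [|i]; [exact: (oW None)|exact: (oW (Some i))].
- exact: oD.
- exact: oX.
Qed.

Lemma attach_closedP (W : set Y) :
  closed W <-> closed (base @^-1` W) /\ forall i, closed (cell i @^-1` W).
Proof.
rewrite -openC attach_openP -[closed (_ @^-1` _)]openC; split=> -[oX oD];
  split=> // i.
- by rewrite -openC; exact: oD.
- by have := oD i; rewrite -openC.
Qed.

Lemma cont_base : continuous base.
Proof. by apply/continuousP => W /attach_openP[]. Qed.

Lemma cont_cell i : continuous (cell i).
Proof. by apply/continuousP => W /attach_openP[_]; apply. Qed.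

(** Crossing with a locally compact space preserves quotient maps.  Currying
    turns [g] into a map from the quotient to a space of functions with the
    compact-open topology, whose continuity can be checked on each summand. *)
Lemma cont_attach_prod (K W : topologicalType) (g : Y * K -> W) :
  locally_compact [set: K] -> hausdorff_space K ->
  continuous (fun u : X * K => g (base u.1, u.2)) ->
  (forall i, continuous (fun u : D * K => g (cell i u.1, u.2))) ->
  continuous g.
Proof.
move=> lK hK gX gD.
have -> : g = uncurry (curry g) by apply/funext => -[].
have cK q : continuous (curry g q).
  case: (attachP q) => [x|i d _].
    by have [_] := continuous_curry gX; apply.
  by have [_] := continuous_curry (gD i); apply.
apply: continuous_uncurry => //.
pose cg : Y -> {compact-open, K -> W} := curry g.
suff: continuous cg by [].
apply: (iffRL (@quotient_continuous _ {eq_quot (glue_equiv bd phi)} _ cg)).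
pose G (o : option I) (u : summand X D o) : {compact-open, K -> W} :=
  curry g (\pi_({eq_quot (glue_equiv bd phi)}) (existT (summand X D) o u)).
have cG o : continuous (G o).
  by case: o => [i|];
    [exact: (continuous_curry_fun (gD i))|exact: (continuous_curry_fun gX)].
by case=> o u A nA; exact: (cG o u A nA).
Qed.

End Attach.

(** * Extending a compatible family over cells *)

Section AttachSystem.
Context (R : realType) (X : topologicalType) (I : choiceType)
  (D : topologicalType).
Context (B : I -> Type) (bd : forall i, B i -> D) (phi : forall i, B i -> X).
Hypothesis phi_bd : forall i (b b' : B i), bd b = bd b' -> phi b = phi b'.

(* The cell [D] is a retract of the normed space [V], from which it gets its
   straight lines.  Near the boundary, on [O], the map [rho] is a retraction
   onto the boundary. *)
Context (V : normedModType R) (io : D -> V) (ka : V -> D) (rho : D -> D).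
Context (O : set D) (b0 : forall i, B i).
Hypotheses (cio : continuous io) (cka : continuous ka) (ioK : cancel io ka).
Hypotheses (crho : continuous rho) (oO : open O).
Hypothesis rho_bd : forall i (b : B i), rho (bd b) = bd b.
Hypothesis O_bd : forall i (b : B i), O (bd b).
Hypothesis rho_O : forall (i : I) d, O d -> range (@bd i) (rho d).
(* This makes continuous the map induced by [phi] on the boundary of [D]. *)
Hypothesis closed_bd : forall i (C : set X), closed C ->
  closed (@bd i @` (@phi i @^-1` C)).

Local Notation Y := (attach bd phi).
Local Notation base := (attach_base bd phi).
Local Notation cell := (attach_cell bd phi).

Context (Z : topologicalType) (z0 : Z) (f : Y -> Z) (cf : continuous f).
Context (g : X -> R -> Z).
Hypothesis sg : path_system z0 (fun x => f (base x)) g.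
Hypothesis cell_transport : forall i (b b' : B i),
  transport z0 (fun v => f (cell i (ka v))) (io (bd b)) (io (bd b'))
    (g (phi b)) (g (phi b')).

Let cbase : continuous base := @cont_base _ _ _ _ bd phi.
Let ccell i : continuous (cell i) := @cont_cell _ _ _ _ bd phi i.

Definition chord (e d : D) (t : R) : D := ka ((1 - t) *: io e + t *: io d).

Lemma chord0 e d : chord e d 0 = e.
Proof. by rewrite /chord subr0 scale1r scale0r addr0 ioK. Qed.

Lemma chord1 e d : chord e d 1 = d.
Proof. by rewrite /chord subrr scale1r scale0r add0r ioK. Qed.

Lemma chord_id d t : chord d d t = d.
Proof. by rewrite /chord -scalerDl subrK scale1r ioK. Qed.

Lemma cont_chord (T : topologicalType) (e d : T -> D) (t : T -> R) :
  continuous e -> continuous d -> continuous t ->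
  continuous (fun x => chord (e x) (d x) (t x)).
Proof. by move=> ce cd ct; rewrite /chord; cont. Qed.

(** A parameter of the boundary point from which [d] is reached.  The default
    value only matters far from the boundary, where nothing is asked about the
    dependence on [d]. *)
Definition foot i (d : D) : B i :=
  if pselect (exists b : B i, bd b = rho d) is left ex then projT1 (cid ex)
  else b0 i.

Lemma bd_foot i d : O d -> bd (foot i d) = rho d.
Proof.
move=> Od; rewrite /foot; case: pselect => [ex|]; first by case: (cid ex).
by case; have [b _ bd_b] := rho_O i Od; exists b.
Qed.

Lemma bd_foot_bd i (b : B i) : bd (foot i (bd b)) = bd b.
Proof. by rewrite bd_foot ?rho_bd. Qed.

Lemma phi_foot_bd i (b : B i) : phi (foot i (bd b)) = phi b.
Proof. exact/phi_bd/bd_foot_bd. Qed.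

Definition cell_path i (d : D) : R -> Z :=
  path_cat (g (phi (foot i d)))
    (fun t => f (cell i (chord (bd (foot i d)) d (clamp 0 1 t)))).

(** The constant second half makes it agree with [cell_path], whose chords
    are constant on the boundary. *)
Definition base_path (x : X) : R -> Z := path_cat (g x) (fun=> f (base x)).

Lemma cell_path_bd i (b : B i) : cell_path i (bd b) = base_path (phi b).
Proof.
rewrite /cell_path /base_path phi_foot_bd bd_foot_bd; congr path_cat.
by apply/funext => t; rewrite chord_id cell_bd.
Qed.

Definition attach_path (q : Y) : R -> Z :=
  match normal q with
  | inl x => base_path x
  | inr (i, d) => cell_path i d
  end.

Lemma attach_path_base x : attach_path (base x) = base_path x.
Proof. by rewrite /attach_path (normal_base phi_bd). Qed.

Lemma attach_path_cell i d : attach_path (cell i d) = cell_path i d.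
Proof.
have [[b _ <-]|nd] := pselect (range (@bd i) d).
  by rewrite cell_bd attach_path_base cell_path_bd.
by rewrite /attach_path (normal_cellE phi_bd) normal_cell_int.
Qed.

Lemma attach_path_cont q : continuous (attach_path q).
Proof.
have cg x := @system_cont _ _ _ _ _ _ sg x.
case: (attachP phi_bd q) => [x|i d _].
  rewrite attach_path_base; apply: path_cat_cont => //; first exact: cont_cst.
  by rewrite (system1 sg).
rewrite attach_path_cell; apply: path_cat_cont => //.
  apply: (cont_comp cf); apply: (cont_comp (@ccell i)).
  by apply: (cont_chord (e := fun=> bd (foot i d)) (d := fun=> d)); cont.
by rewrite (system1 sg) clamp_id // chord0 cell_bd.
Qed.

Lemma attach_path0 q : attach_path q 0 = z0.
Proof.
case: (attachP phi_bd q) => [x|i d _].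
  by rewrite attach_path_base /base_path path_cat0 (system0 sg).
by rewrite attach_path_cell /cell_path path_cat0 (system0 sg).
Qed.

Lemma attach_path1 q : attach_path q 1 = f q.
Proof.
case: (attachP phi_bd q) => [x|i d _].
  by rewrite attach_path_base /base_path path_cat1.
by rewrite attach_path_cell /cell_path path_cat1 clamp_id // chord1.
Qed.

Definition collar : set Y := [set q | forall i d, q = cell i d -> O d].

Lemma collar_base x : collar (base x).
Proof.
move=> i d e; have := congr1 (@normal _ _ _ _ bd phi) e.
rewrite (normal_base phi_bd) (normal_cellE phi_bd);
  have [[b _ <- _]|nd] := pselect (range (@bd i) d).
  exact: O_bd.
by rewrite normal_cell_int.
Qed.

Lemma collar_cell i d : collar (cell i d) <-> O d.
Proof.
split=> [|Od]; first exact.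
have [[b _ <-]|nd] := pselect (range (@bd i) d).
  by rewrite cell_bd; exact: collar_base.
move=> j d' e; have := congr1 (@normal _ _ _ _ bd phi) e.
rewrite !(normal_cellE phi_bd) (normal_cell_int phi nd).
have [[b _ <-]|nd'] := pselect (range (@bd j) d');
  first by rewrite normal_cell_bd.
by rewrite normal_cell_int // => -[_ <-].
Qed.

Lemma open_collar : open collar.
Proof.
apply/attach_openP; split=> [|i].
- by rewrite (_ : base @^-1` _ = setT);
    [exact: openT|apply/seteqP; split=> // x _; exact: collar_base].
- by rewrite (_ : cell i @^-1` _ = O) //; apply/seteqP;
    split=> d /(collar_cell i).
Qed.

Definition collar_retract (q : Y) : X :=
  match normal q with
  | inl x => x
  | inr (i, d) => phi (foot i d)
  end.

Lemma retract_base x : collar_retract (base x) = x.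
Proof. by rewrite /collar_retract (normal_base phi_bd). Qed.

Lemma retract_cell i d : collar_retract (cell i d) = phi (foot i d).
Proof.
have [[b _ <-]|nd] := pselect (range (@bd i) d).
  by rewrite cell_bd retract_base phi_foot_bd.
by rewrite /collar_retract (normal_cellE phi_bd) normal_cell_int.
Qed.

(** The preimage of a closed set [C] is the trace on the collar of a closed
    set [E] of [Y], which is defined in terms of [rho] even outside the collar,
    where the retraction is not continuous. *)
Lemma cont_retract (p : R -> Y) : continuous p -> (forall s, collar (p s)) ->
  continuous (fun s => collar_retract (p s)).
Proof.
move=> cp colp; apply/continuous_closedP => C cC.
pose E := [set q : Y | match normal q with
  | inl x => C x
  | inr (i, d) => (@bd i @` (@phi i @^-1` C)) (rho d) end].
have EX x : E (base x) <-> C x by rewrite /E /= (normal_base phi_bd).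
have Ebd i (b : B i) : (@bd i @` (@phi i @^-1` C)) (bd b) <-> C (phi b).
  split=> [[b' /= Cb' /phi_bd <- //]|Cb]; by exists b.
have ED i d : E (cell i d) <-> (@bd i @` (@phi i @^-1` C)) (rho d).
  have [[b _ <-]|nd] := pselect (range (@bd i) d).
    by rewrite cell_bd rho_bd EX Ebd.
  by rewrite /E /= (normal_cellE phi_bd) normal_cell_int.
have cE : closed E.
  apply/attach_closedP; split=> [|i].
    by rewrite (_ : base @^-1` _ = C) //; apply/seteqP; split=> x /EX.
  rewrite (_ : cell i @^-1` _ = rho @^-1` (@bd i @` (@phi i @^-1` C))).
    by move/continuous_closedP: crho; apply; exact: closed_bd.
  by apply/seteqP; split=> d /ED.
rewrite (_ : (fun s => collar_retract (p s)) @^-1` _ = p @^-1` E);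
  first by move/continuous_closedP: cp; apply.
suff rE q : collar q -> E q <-> C (collar_retract q).
  by apply/seteqP; split=> s /=; rewrite rE.
case: (attachP phi_bd q) => [x _|i d _ /collar_cell Od].
  by rewrite EX retract_base.
by rewrite ED retract_cell -(bd_foot i Od) Ebd.
Qed.

(** Along the chords, from the retraction onto [X] to the identity.  Since
    [rho] is continuous on the whole cell, so is this map on [Y * R], although
    it starts in [X] on the collar only. *)
Definition spread (q : Y * R) : Y :=
  match normal q.1 with
  | inl x => base x
  | inr (i, d) => cell i (chord (rho d) d q.2)
  end.

Lemma spread_base x t : spread (base x, t) = base x.
Proof. by rewrite /spread (normal_base phi_bd). Qed.

Lemma spread_cell i d t : spread (cell i d, t) = cell i (chord (rho d) d t).
Proof.
have [[b _ <-]|nd] := pselect (range (@bd i) d).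
  by rewrite rho_bd chord_id !cell_bd spread_base.
by rewrite /spread (normal_cellE phi_bd) normal_cell_int.
Qed.

Lemma cont_spread : continuous spread.
Proof.
apply: (cont_attach_prod phi_bd).
- exact: locally_compactR.
- exact: Rhausdorff.
- have -> : (fun u : X * R => spread (base u.1, u.2)) = fun u => base u.1.
    by apply/funext => u; rewrite spread_base.
  by cont.
- move=> i; have -> : (fun u : D * R => spread (cell i u.1, u.2)) =
      fun u => cell i (chord (rho u.1) u.1 u.2).
    by apply/funext => u; rewrite spread_cell.
  by apply: (cont_comp (@ccell i));
    apply: (cont_chord (e := fun u => rho u.1) (d := fun u => u.1)
    (t := fun u => u.2)); cont.
Qed.

Lemma spread0 q : collar q -> spread (q, 0) = base (collar_retract q).
Proof.
case: (attachP phi_bd q) => [x _|i d _ /collar_cell Od].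
  by rewrite spread_base retract_base.
by rewrite spread_cell retract_cell chord0 -(bd_foot i Od) cell_bd.
Qed.

Lemma spread1 q : spread (q, 1) = q.
Proof.
case: (attachP phi_bd q) => [x|i d _]; first by rewrite spread_base.
by rewrite spread_cell chord1.
Qed.

(** On the collar the chord leading to a point is its track under [spread]. *)
Lemma attach_path_collar q : collar q -> attach_path q =
  path_cat (g (collar_retract q)) (fun t => f (spread (q, clamp 0 1 t))).
Proof.
case: (attachP phi_bd q) => [x _|i d _ /collar_cell Od].
  rewrite attach_path_base /base_path retract_base; congr path_cat.
  by apply/funext => t; rewrite spread_base.
rewrite attach_path_cell /cell_path retract_cell; congr path_cat.
by apply/funext => t; rewrite spread_cell bd_foot.
Qed.

(** Below, the square of the retracted path; above, the region swept by
    [spread] between the retracted path and [p]. *)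
Lemma square_collar (p : R -> Y) a b : continuous p -> a <= b ->
  (forall s, a <= s -> s <= b -> collar (p s)) ->
  square z0 a b (fun s => f (p s)) (attach_path (p a)) (attach_path (p b)).
Proof.
move=> cp ab colp; pose p' s := p (clamp a b s).
have cp' : continuous p' by rewrite /p'; cont.
have colp' s : collar (p' s) by apply: colp; [exact: clamp_ge|exact: clamp_le].
have p'E s : a <= s -> s <= b -> p' s = p s by move=> ? ?; rewrite /p' clamp_id.
have := system_square sg (cont_retract cp' colp') ab.
rewrite !p'E // => sq; rewrite !attach_path_collar; try exact: colp.
pose G (u : R * R) := f (spread (p' u.1, clamp 0 1 u.2)).
have cG : continuous G by rewrite /G; have cs := cont_spread; cont.
have := square_stack (top := fun s => f (p s)) ab sq cG.
rewrite /G /= !p'E //; apply=> s as_ sb; rewrite clamp_id //.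
  by rewrite spread0.
by rewrite spread1 p'E.
Qed.

Definition inner i : set Y := cell i @` (~` range (@bd i)).

Lemma inner_cellP i (W : set D) j d :
  (cell i @` (W `&` ~` range (@bd i))) (cell j d) <->
  j = i /\ (W `&` ~` range (@bd i)) d.
Proof.
split=> [[d' [Wd' nd'] e]|[-> Wd]]; last by exists d.
have := congr1 (@normal _ _ _ _ bd phi) e;
  rewrite !(normal_cellE phi_bd) (normal_cell_int phi nd').
have [[b _ <-]|nd] := pselect (range (@bd j) d);
  first by rewrite normal_cell_bd.
by rewrite normal_cell_int // => -[<- <-].
Qed.

Lemma open_inner i (W : set D) : open W ->
  open (cell i @` (W `&` ~` range (@bd i))).
Proof.
move=> oW; apply/attach_openP; split=> [|j].
  rewrite (_ : _ @^-1` _ = set0); first exact: open0.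
  apply/seteqP; split=> // x [d [_ nd] e].
  have := congr1 (@normal _ _ _ _ bd phi) e.
  by rewrite (normal_base phi_bd) (normal_cellE phi_bd) normal_cell_int.
have [->|ji] := eqVneq j i; last first.
  rewrite (_ : _ @^-1` _ = set0); first exact: open0.
  by apply/seteqP; split=> // d /inner_cellP[/eqP]; rewrite (negbTE ji).
rewrite (_ : _ @^-1` _ = W `&` ~` range (@bd i)).
  apply: openI => //; apply: closed_openC.
  by have := @closed_bd i setT (@closedT X); rewrite preimage_setT.
by apply/seteqP; split=> d => [/inner_cellP[]|Wd] //; exists d.
Qed.

(** Below, a square carrying the path chosen at the foot of [p a] to the one
    chosen at the foot of [p b] across the cell; above, the straight lines in
    the cell from the top of that square to [p], which are the chords at both
    ends. *)
Lemma square_inner i (p : R -> Y) a b : continuous p -> a <= b ->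
  (forall s, a <= s -> s <= b -> inner i (p s)) ->
  square z0 a b (fun s => f (p s)) (attach_path (p a)) (attach_path (p b)).
Proof.
move=> cp; rewrite le_eqVlt => /predU1P[<- {b}|ab] inp.
  apply: (@eq_square _ _ _ a a (fun=> f (p a)) _ (attach_path (p a)) _
    (attach_path (p a))) => //.
    by move=> s as_ sa; rewrite (_ : s = a) //; apply: le_anti; rewrite as_ sa.
  by apply: square_cst;
    [exact: attach_path_cont|exact: attach_path0|exact: attach_path1].
have leab := ltW ab; pose p' s := p (clamp a b s).
have cp' : continuous p' by rewrite /p'; cont.
have inp' s : inner i (p' s) by apply: inp; [exact: clamp_ge|exact: clamp_le].
have p'E s : a <= s -> s <= b -> p' s = p s by move=> ? ?; rewrite /p' clamp_id.
pose d s := projT1 (cid2 (inp' s)).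
have nd s : ~ range (@bd i) (d s) by rewrite /d; case: (cid2 (inp' s)).
have dE s : cell i (d s) = p' s by rewrite /d; case: (cid2 (inp' s)).
have cd : continuous d.
  apply/continuousP => W oW.
  rewrite (_ : _ @^-1` _ = p' @^-1` (cell i @` (W `&` ~` range (@bd i)))).
    by move/continuousP: cp'; apply; exact: open_inner.
  apply/seteqP; split=> s /=; rewrite -dE.
    by move=> Wd; exists (d s) => //; split=> //; exact: nd.
  by move/inner_cellP => [_ []].
have [w [cw w0 w1 sq]] := cell_transport (foot i (d a)) (foot i (d b)).
pose h s := (b - a)^-1 * (s - a).
have ch : continuous h by rewrite /h; cont.
have ba0 : 0 < b - a by rewrite subr_gt0.
have ha : h a = 0 by rewrite /h subrr mulr0.
have hb : h b = 1 by rewrite /h mulVf // gt_eqF.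
have hab s : a <= s -> s <= b -> 0 <= h s /\ h s <= 1.
  move=> as_ sb; split; first by rewrite mulr_ge0 ?invr_ge0 ?subr_ge0.
  by rewrite /h mulrC ler_pdivrMr // mul1r lerD2r.
have sq' := square_reparam ch ha hb hab sq.
pose G (u : R * R) := f (cell i (ka
  ((1 - clamp 0 1 u.2) *: w (h u.1) + clamp 0 1 u.2 *: io (d u.1)))).
have ccl := @ccell i.
have cG : continuous G by rewrite /G; cont.
have := square_stack (top := fun s => f (p s)) leab sq' cG.
rewrite /G /= ha hb w0 w1 -(p'E a) // -(p'E b) // -!dE !attach_path_cell.
apply=> s as_ sb; rewrite clamp_id //.
  by rewrite subr0 scale1r scale0r addr0.
by rewrite subrr scale0r add0r scale1r ioK dE p'E.
Qed.

(** The collar and the interiors of the cells form an open cover, so that it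
    is enough to treat paths that stay in one of them. *)
Theorem attach_system : path_system z0 f attach_path.
Proof.
split; [exact: attach_path_cont|exact: attach_path0|exact: attach_path1|].
move=> p a b cp ab.
apply: (@nbhs_induction _ (fun x y => square z0 x y (fun s => f (p s))
  (attach_path (p x)) (attach_path (p y)))) => // [x y z _ xy yz _|s as_ sb].
  exact: square_cat.
have [cs|ncs] := pselect (collar (p s)).
  exists (p @^-1` collar).
    by apply: open_nbhs_nbhs; split=> //; move/continuousP: cp; apply;
      exact: open_collar.
  by move=> x y ax xy yb N; exact: square_collar.
have [q e] : exists q, q = p s by exists (p s).
rewrite -e in ncs; case: (attachP phi_bd q) e ncs => [x _|i d nd e _].
  by case; exact: collar_base.
exists (p @^-1` inner i).
  apply: open_nbhs_nbhs; split; last by exists d.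
  move/continuousP: cp; apply; rewrite /inner -[~` _]setTI; apply: open_inner.
  exact: openT.
by move=> x y ax xy yb N; exact: (@square_inner i).
Qed.

End AttachSystem.

(** * Distances and magnitude chains *)

Lemma homology_eq0 (A B C : zmodType) (f : {additive A -> B})
  (g : {additive B -> C}) :
  (forall h : homology f g, h = 0) -> forall b, g b = 0 -> exists a, f a = b.
Proof.
move=> H0 b gb; have cb : b \in is_cycle g by rewrite unfold_in gb.
pose z : cycles g := Sub b cb.
have : z - 0 \in (@is_boundary _ _ _ f g).
  by rewrite Quotient.idealrBE; apply/eqP; rewrite [LHS]H0 [RHS]H0.
by rewrite subr0 => /asboolP.
Qed.

Section Distance.
Context (T : finType) (e : rel T) (e_conn : forall x y : T, connect e x y).
Local Open Scope nat_scope.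

(** The distance of a connected graph, where [dist] is never infinite. *)
Definition ndist (x y : T) : nat := odflt 0 (dist e x y).

Lemma path_of_lengthP x y n : reflect
  (exists p, [/\ path e x p, last x p = y & size p = n])
    (path_of_length e x y n).
Proof.
apply: (iffP existsP) => [[p /andP[xp /eqP xy]]|[p [xp xy sp]]].
  by exists p; rewrite size_tuple.
by exists (tcast sp (in_tuple p)); rewrite val_tcast /= xp xy eqxx.
Qed.

Lemma ndist_spec x y : dist e x y = Some (ndist x y) /\
  (exists p, [/\ path e x p, last x p = y & size p = ndist x y]) /\
  (forall p, path e x p -> last x p = y -> ndist x y <= size p).
Proof.
rewrite /ndist /dist; case: pselect => [ex|[]]; last first.
  have /connectP[p xp ->] := e_conn x y.
  by exists (size p); apply/path_of_lengthP; exists p.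
case: ex_minnP => n /path_of_lengthP xyn nmin; split=> //; split=> // p xp xy.
by apply: nmin; apply/path_of_lengthP; exists p.
Qed.

Lemma dist_ndist x y : dist e x y = Some (ndist x y).
Proof. by case: (ndist_spec x y). Qed.

Lemma ndist_le x p : path e x p -> ndist x (last x p) <= size p.
Proof. by move=> xp; case: (ndist_spec x (last x p)) => _ [_]; apply. Qed.

Definition geodesic (x y : T) : seq T :=
  projT1 (cid (proj1 (proj2 (ndist_spec x y)))).

Lemma geodesic_path x y : path e x (geodesic x y).
Proof. by rewrite /geodesic; case: cid => p []. Qed.

Lemma geodesic_last x y : last x (geodesic x y) = y.
Proof. by rewrite /geodesic; case: cid => p []. Qed.

Lemma geodesic_size x y : size (geodesic x y) = ndist x y.
Proof. by rewrite /geodesic; case: cid => p []. Qed.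

Lemma ndistxx x : ndist x x = 0.
Proof. by apply/eqP; rewrite -leqn0; exact: (@ndist_le x [::]). Qed.

Lemma ndist_eq0 x y : (ndist x y == 0) = (x == y).
Proof.
apply/eqP/eqP => [|->]; last exact: ndistxx.
by rewrite -geodesic_size => /size0nil g0; rewrite -(geodesic_last x y) g0.
Qed.

Lemma ndist_triangle y x z : ndist x z <= ndist x y + ndist y z.
Proof.
have := @ndist_le x (geodesic x y ++ geodesic y z).
by rewrite cat_path last_cat !geodesic_last size_cat !geodesic_size
  !geodesic_path; apply.
Qed.

Lemma is_generator3 k x y z : is_generator e k [tuple x; y; z] =
  [&& x != y, y != z & ndist x y + ndist y z == k].
Proof.
rewrite /is_generator /norm /= theadE /= !dist_ndist /Defs.addo addn0 andbA;
  congr (_ && _).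
apply/forallP/andP => [H|[xy yz] i].
  have := H ord0; have := H (lift ord0 ord0).
  by rewrite !(tnth_nth x) /= => -> ->.
by case: i => -[|[|i]] //= Hi; rewrite !(tnth_nth x).
Qed.

Lemma is_generator4 k x y y' z : is_generator e k [tuple x; y; y'; z] =
  [&& x != y, y != y', y' != z & ndist x y + ndist y y' + ndist y' z == k].
Proof.
rewrite /is_generator /norm /= theadE /= !dist_ndist /Defs.addo addn0 addnA
  !andbA; congr (_ && _).
apply/forallP/andP => [H|[/andP[xy yy'] y'z] i].
  have := H ord0; have := H (lift ord0 ord0);
    have := H (lift ord0 (lift ord0 ord0)).
  by rewrite !(tnth_nth x) /= => -> -> ->.
by case: i => -[|[|[|i]]] //= Hi; rewrite !(tnth_nth x).
Qed.

End Distance.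

Section Functional.
Context (T : finType) (e : rel T) (e_conn : forall x y : T, connect e x y).
Context (k : nat).

(** Contribution of a face to a functional: a face whose length has dropped is
    zero in the magnitude complex. *)
Definition on_face (n : nat) (F : n.+1.-tuple T -> int) (t : n.+1.-tuple T) :
  int :=
  if is_generator e k t then F t else 0.

Lemma sum_face n (F : n.+1.-tuple T -> int) (t : n.+1.-tuple T) :
  \sum_(y : generator e n k) ((insub t : option (generator e n k)) == Some y)%:R
    * F (val y) = on_face F t.
Proof.
rewrite /on_face; case: insubP => [w -> <-|/negbTE->]; last first.
  by rewrite big1 // => y _; rewrite mul0r.
rewrite (bigD1 w) //= eqxx mul1r big1 ?addr0 // => y yw.
by rewrite (_ : (Some w == Some y) = false) ?mul0r // -[RHS](negbTE yw) eq_sym.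
Qed.

Lemma sum_diffS n (c : MC e n.+1 k) (F : n.+1.-tuple T -> int) :
  \sum_y diffS c y * F (val y) =
  \sum_u c u * \sum_(i < n.+2) (-1) ^+ i * on_face F (delete i (val u)).
Proof.
under eq_bigr => y _ do rewrite ffunE big_distrl /=.
rewrite exchange_big /=; apply: eq_bigr => u _.
under eq_bigr => y _ do rewrite big_distrl /=.
rewrite exchange_big big_distrr /=; apply: eq_bigr => i _.
rewrite -sum_face !big_distrr /=; apply: eq_bigr => y _.
by rewrite !mulrA [c u * _]mulrC.
Qed.

Lemma delete_4 (x y y' z : T) (i : 'I_4) :
  delete i [tuple x; y; y'; z] =
  nth [tuple y; y'; z]
    [:: [tuple y; y'; z]; [tuple x; y'; z]; [tuple x; y; z]; [tuple x; y; y']]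
    i.
Proof.
case: i => -[|[|[|[|i]]]] //= Hi; apply: eq_from_tnth;
  case=> -[|[|[|j]]] //= Hj;
  by rewrite tnth_mktuple !(tnth_nth x).
Qed.

Lemma delete_3 (x y z : T) (i : 'I_3) :
  delete i [tuple x; y; z] =
  nth [tuple y; z] [:: [tuple y; z]; [tuple x; z]; [tuple x; y]] i.
Proof.
case: i => -[|[|[|i]]] //= Hi; apply: eq_from_tnth; case=> -[|[|j]] //= Hj;
  by rewrite tnth_mktuple !(tnth_nth x).
Qed.

(** Removing an end of a tuple decreases its length, so that only the two inner
    faces count, and they come with opposite signs. *)
Lemma functional_boundary (F : 3.-tuple T -> int) :
  (forall x y y' z, (ndist e x y + ndist e y y' + ndist e y' z = k)%N ->
     x != y -> y != y' -> y' != z ->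
     on_face F [tuple x; y'; z] = on_face F [tuple x; y; z]) ->
  forall c : MC e 3 k, \sum_y diffS c y * F (val y) = 0.
Proof.
move=> HF c; rewrite sum_diffS big1 // => -[u ug] _ /=.
case/tupleP: u ug => x u; case/tupleP: u => y u; case/tupleP: u => y' u.
case/tupleP: u => z u; rewrite (tuple0 u) => ug.
have := ug; rewrite is_generator4 // => /and4P[xy yy' y'z /eqP uk].
rewrite !big_ord_recl big_ord0 /= !delete_4 /=.
have dxy : (ndist e x y != 0)%N by rewrite ndist_eq0.
have dyz : (ndist e y' z != 0)%N by rewrite ndist_eq0.
rewrite (_ : on_face F [tuple y; y'; z] = 0); last first.
  by rewrite /on_face is_generator3 // ifF //; apply/negP => /and3P[_ _ /eqP];
    lia.
rewrite (_ : on_face F [tuple x; y; y'] = 0); last first.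
  by rewrite /on_face is_generator3 // ifF //; apply/negP => /and3P[_ _ /eqP];
    lia.
rewrite (HF _ _ _ _ uk xy yy' y'z) !mulr0 add0r !addr0.
by rewrite /bump /= !expr2 expr1 mulrN1 opprK mul1r mulN1r addNr mulr0.
Qed.

End Functional.

(** * Local systems on a graph *)

Section LocalSystem.
Context (T : finType) (e : rel T).
Context (e_irr : irreflexive e) (e_sym : symmetric e).
Context (e_conn : forall x y : T, connect e x y).
Context (MH2_eq0 : forall k : nat, (2 < k)%N -> forall h : MH e 2 k, h = 0).
(* A local system of sets: [fiber x] is the set over the vertex [x], on which
   the edge from [x] to [y] acts by [act x y]. *)
Context (S : Type) (fiber : T -> S -> Prop) (act : T -> T -> S -> S).
Local Open Scope nat_scope.

Fixpoint monodromy (x : T) (p : seq T) (c : S) : S :=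
  if p is y :: q then monodromy y q (act x y c) else c.

Hypothesis fiber_act : forall x y c, e x y -> fiber x c -> fiber y (act x y c).
Hypothesis short_loops : forall x p c, path e x p -> last x p = x ->
  size p <= 4 -> fiber x c -> monodromy x p c = c.

Lemma monodromy_cat x p q c : monodromy x (p ++ q) c = monodromy (last x p) q
  (monodromy x p c).
Proof. by elim: p x c => //= y p IH x c. Qed.

Lemma fiber_monodromy x p c : path e x p -> fiber x c ->
  fiber (last x p) (monodromy x p c).
Proof.
by elim: p x c => //= y p IH x c /andP[xy yp] gc; apply: IH => //;
  exact: fiber_act.
Qed.

Lemma act_back x y c : e x y -> fiber x c -> act y x (act x y c) = c.
Proof.
move=> xy gc; apply: (@short_loops x [:: y; x]) => //=.
by rewrite xy e_sym xy.
Qed.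

Lemma rev_walk x p : path e x p -> path e (last x p) (rev (belast x p)).
Proof. by rewrite rev_path; congr (is_true _); apply: eq_path => y z;
  exact: e_sym. Qed.

Lemma last_rev_walk (x : T) p : last (last x p) (rev (belast x p)) = x.
Proof. by case: p => //= y p; rewrite rev_cons last_rcons. Qed.

Lemma monodromy_rcons x p y c :
  monodromy x (rcons p y) c = act (last x p) y (monodromy x p c).
Proof. by rewrite -cats1 monodromy_cat. Qed.

Lemma monodromy_rev x p d : path e x p -> fiber (last x p) d ->
  monodromy x p (monodromy (last x p) (rev (belast x p)) d) = d.
Proof.
elim: p x d => //= y p IH x d /andP[xy yp] gd.
rewrite rev_cons monodromy_rcons last_rev_walk act_back ?IH //;
  first by rewrite e_sym.
by rewrite -[X in fiber X _](last_rev_walk y p); apply: fiber_monodromy => //;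
  exact: rev_walk.
Qed.

Section Step.
Context (n : nat) (n5 : 5 <= n).
Hypothesis IH : forall x p q c, path e x p -> path e x q ->
  last x p = last x q ->
  size p + size q < n -> fiber x c -> monodromy x p c = monodromy x q c.

Section Halves.
(* The two halves of a closed walk of length [n] with nontrivial monodromy. *)
Context (x z : T) (A B : seq T) (c : S) (gc : fiber x c).
Context (xA : path e x A) (xB : path e x B) (Az : last x A = z)
  (Bz : last x B = z).
Context (AB : size A + size B = n) (BA : size B <= size A)
  (AB1 : size A <= (size B).+1).
Hypothesis neqAB : monodromy x A c <> monodromy x B c.

Let k := size A.

Local Notation geodesic := (geodesic e_conn).
Local Notation ndist := (ndist e).

Let gpath := geodesic_path e_conn.
Let glast := geodesic_last e_conn.
Let gsize := geodesic_size e_conn.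

Definition via y := monodromy x (geodesic x y ++ geodesic y z) c.

(** Two geodesics from [x] to [y] form a closed walk of length at most
    2 (k - 1) < n, and similarly from [y] to [z]. *)
Lemma via_geodesic y P Q : ndist x y + ndist y z = k -> x != y -> y != z ->
  path e x P -> last x P = y -> size P <= ndist x y ->
  path e y Q -> last y Q = z -> size Q <= ndist y z ->
  monodromy x (P ++ Q) c = via y.
Proof.
move=> xyz xy yz xP Py sP yQ Qz sQ; rewrite /via !monodromy_cat Py glast.
have dxy : ndist x y != 0 by rewrite ndist_eq0.
have dyz : ndist y z != 0 by rewrite ndist_eq0.
rewrite (@IH x P (geodesic x y)) //; first last.
- rewrite gsize; lia.
- by rewrite glast.
apply: IH => //; first by rewrite glast.
  rewrite gsize; lia.
by rewrite -[X in fiber X _](glast x y); apply: fiber_monodromy.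
Qed.

(** By induction [W] acts like [B], because [size W + size B < n]. *)
Lemma via_not_short y P Q : ndist x y + ndist y z = k -> x != y -> y != z ->
  path e x P -> last x P = y -> path e y Q -> last y Q = z ->
  size P <= ndist x y -> size Q <= ndist y z ->
  forall W, path e x W -> last x W = z -> size W < k ->
  monodromy x (P ++ Q) c = monodromy x W c -> via y <> monodromy x A c.
Proof.
move=> xyz xy yz xP Py yQ Qz sP sQ W xW Wz sW PQW vA; apply: neqAB.
rewrite -vA -(via_geodesic xyz xy yz xP Py sP yQ Qz sQ) PQW.
apply: IH => //; [by rewrite Wz Bz|rewrite /k in sW; lia].
Qed.

(** Indicator of the generators (x, y, z) such that walks through [y] act like
    [A]. *)
Definition weight (t : 3.-tuple T) : int :=
  match tval t with
  | [:: x'; y; z'] =>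
    ([&& x' == x, z' == z & `[< via y = monodromy x A c >]] : nat)%:R
  | _ => 0%R
  end.

(** If both faces are nonzero, a walk through [y] and then [y'] is a walk of
    minimal length for both of them.  If only one is, some part of that walk is
    not a geodesic, and replacing it by a geodesic gives a shorter walk. *)
Lemma weight_boundary x' y y' z' : ndist x' y + ndist y y' + ndist y' z' = k ->
  x' != y -> y != y' -> y' != z' ->
  on_face e k weight [tuple x'; y'; z'] = on_face e k weight [tuple x'; y; z'].
Proof.
move=> uk xy yy' yz; rewrite /on_face !is_generator3 // /weight /=.
case: (eqVneq x' x) uk xy => [->|_] uk xy; last by rewrite !if_same.
case: (eqVneq z' z) uk yz => [->|_] uk yz; last by rewrite !if_same.
rewrite xy yz /=.
have dxy : ndist x y != 0 by rewrite ndist_eq0.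
have dyy : ndist y y' != 0 by rewrite ndist_eq0.
have dyz : ndist y' z != 0 by rewrite ndist_eq0.
have t1 : ndist x y' <= ndist x y + ndist y y' by exact: ndist_triangle.
have t2 : ndist y z <= ndist y y' + ndist y' z by exact: ndist_triangle.
have xy'k : ndist x y' + ndist y' z = k ->
  x != y' by rewrite -(ndist_eq0 e_conn); lia.
have yzk : ndist x y + ndist y z = k ->
  y != z by rewrite -(ndist_eq0 e_conn); lia.
have [e1|n1] := eqVneq (ndist x y' + ndist y' z) k;
have [e2|n2] := eqVneq (ndist x y + ndist y z) k; rewrite ?andbF //=.
(* both inner faces are nonzero *)
- rewrite xy'k // yzk //=; congr (nat_of_bool _)%:R; congr asbool.
  have -> // : via y' = via y.
  rewrite -(@via_geodesic y' (geodesic x y ++ geodesic y y') (geodesic y' z))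
    ?xy'k //.
  + rewrite -catA; apply: via_geodesic; rewrite ?yzk //.
    * by rewrite gsize.
    * by rewrite cat_path glast !gpath.
    * by rewrite last_cat !glast.
    * rewrite size_cat !gsize; lia.
  + by rewrite cat_path glast !gpath.
  + by rewrite last_cat !glast.
  + rewrite size_cat !gsize; lia.
  + by rewrite gsize.
(* only (x, y', z) is nonzero: the part from [y] to [z] can be shortened *)
- rewrite xy'k //= asboolF //.
  apply: (@via_not_short y' (geodesic x y ++ geodesic y y') (geodesic y' z) _ _
    _ _ _ _ _ _ _
    (geodesic x y ++ geodesic y z));
      rewrite ?xy'k ?cat_path ?last_cat ?glast ?gpath //.
  + rewrite size_cat !gsize; lia.
  + by rewrite gsize.
  + rewrite size_cat !gsize; lia.
  + rewrite -catA !(monodromy_cat x (geodesic x y)) glast; apply: IH;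
      rewrite ?cat_path ?last_cat ?glast ?gpath //.
      rewrite size_cat !gsize; lia.
    by rewrite -[X in fiber X _](glast x y); apply: fiber_monodromy.
(* only (x, y, z) is nonzero: the part from [x] to [y'] can be shortened *)
- rewrite yzk //= asboolF //.
  apply: (@via_not_short y (geodesic x y) (geodesic y y' ++ geodesic y' z) _ _ _
    _ _ _ _ _ _
    (geodesic x y' ++ geodesic y' z));
      rewrite ?yzk ?cat_path ?last_cat ?glast ?gpath //.
  + by rewrite gsize.
  + rewrite size_cat !gsize; lia.
  + rewrite size_cat !gsize; lia.
  + rewrite catA [in LHS]monodromy_cat [in RHS]monodromy_cat last_cat !glast.
    congr monodromy; apply: IH; rewrite ?cat_path ?last_cat ?glast ?gpath //.
    rewrite size_cat !gsize; lia.
Qed.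

(** A geodesic from [y] to [z] shorter than the rest of [P] would give a walk
    shorter than [P] that acts in the same way. *)
Lemma generator_of_walk P : path e x P -> last x P = z -> size P = k ->
  (forall W, path e x W -> last x W = z -> size W < k ->
    monodromy x W c <> monodromy x P c) ->
  exists y, is_generator e k [tuple x; y; z] /\ via y = monodromy x P c.
Proof.
case: P => [|y P]; first by rewrite /k /=; lia.
move=> /= /andP[xy yP] Pz sP Pmin; exists y.
have nxy : x != y by apply: contraTneq xy => ->; rewrite e_irr.
have dxy : ndist x y = 1.
  have := ndist_eq0 e_conn x y; have := @ndist_le _ _ e_conn x [:: y];
    rewrite /= xy => /(_ isT).
  by rewrite (negbTE nxy); lia.
have dyz : ndist y z = k.-1.
  have := @ndist_le _ _ e_conn y P yP; rewrite Pz => dP.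
  have [dk|] := ltnP (ndist y z) k.-1; last by lia.
  case: (Pmin (y :: geodesic y z)) => /=.
  - by rewrite xy gpath.
  - by rewrite glast.
  - rewrite gsize; lia.
  apply: IH => //; [by rewrite glast|rewrite gsize; lia|exact: fiber_act].
have nyz : y != z by rewrite -(ndist_eq0 e_conn); lia.
split; first by rewrite is_generator3 // nxy nyz /=; apply/eqP; lia.
rewrite -(@via_geodesic y [:: y] P) //=; [lia|by rewrite xy|lia|lia].
Qed.

Let delta (w : generator e 2 k) : MC e 2 k := [ffun v => ((v == w) : nat)%:R].

Lemma sum_delta (w : generator e 2 k) (F : generator e 2 k -> int) :
  (\sum_v delta w v * F v = F w)%R.
Proof.
rewrite (bigD1 w) //= ffunE eqxx mul1r big1 ?addr0 // => v vw.
by rewrite ffunE (negbTE vw) mul0r.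
Qed.

Lemma diff_delta y (yg : is_generator e k [tuple x; y; z]) (t : generator e 1 k)
  :
  diffS (delta (Sub _ yg)) t = (- ((insub [tuple x; z] == Some t) : nat)%:R)%R.
Proof.
have := yg; rewrite is_generator3 // => /and3P[xy yz /eqP xyz].
have dxy : ndist x y != 0 by rewrite ndist_eq0.
have dyz : ndist y z != 0 by rewrite ndist_eq0.
have gen2 a b : is_generator e k [tuple a; b] -> ndist a b = k.
  by rewrite /is_generator /norm /= theadE (dist_ndist e_conn) /Defs.addo addn0
    => /andP[_ /eqP[]].
rewrite ffunE (bigD1 (Sub _ yg)) //= [X in (_ + X)%R]big1 ?addr0; last first.
  by move=> v vw; rewrite big1 // => i _; rewrite ffunE (negbTE vw) mulr0 mul0r.
have -> : delta (Sub _ yg) (Sub _ yg) = 1%R by rewrite ffunE eqxx.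
rewrite !big_ord_recl big_ord0 /face !delete_3 /= !mulr1 addr0.
rewrite [in X in (X + _)%R]insubN; last by apply/negP => /gen2; lia.
rewrite [in X in (_ + (_ + X))%R]insubN; last by apply/negP => /gen2; lia.
by rewrite /= !mulr0 add0r addr0 mulN1r.
Qed.

Lemma weight_sum y (yg : is_generator e k [tuple x; y; z]) :
  weight (val (Sub _ yg : generator e 2 k)) =
    (`[< via y = monodromy x A c >] : nat)%:R%R.
Proof. by rewrite /weight /= !eqxx. Qed.

(** The boundary of the generator given by [A] only involves the face (x, z),
    which is zero if [B] is shorter than [A], because then d(x, z) < k.
    Otherwise [B] gives another generator with the same boundary, and of
    weight 0, to be subtracted.  In both cases the result is a cycle of weight
    1, hence not a boundary, and MH_{2,k} is not zero. *)
Lemma halves_contradiction : False.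
Proof.
have k3 : 2 < k by rewrite /k; lia.
have exact_zero (d : MC e 2 k) : diffS d = 0%R ->
  (\sum_y d y * weight (val y) = 0)%R.
  move=> dd; have [b <-] := homology_eq0 (MH2_eq0 k3)
    (dd : @Defs.diff _ e 2 k d = 0%R).
  exact: (functional_boundary e_conn weight_boundary b).
have [yA [gA vA]] : exists y, is_generator e k [tuple x; y; z] /\ via y =
  monodromy x A c.
  apply: generator_of_walk => // W xW Wz sW WA; apply: neqAB; rewrite -WA.
  by apply: IH => //; [rewrite Wz|rewrite /k in sW; lia].
have [sB|sB] := eqVneq (size B) k.
  have [yB [gB vB]] : exists y, is_generator e k [tuple x; y; z] /\ via y =
    monodromy x B c.
    apply: generator_of_walk => // W xW Wz sW WB; apply: neqAB; rewrite -WB.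
    by apply: IH => //; [rewrite Wz|rewrite /k in sW; lia].
  have dd : diffS (delta (Sub _ gA) - delta (Sub _ gB))%R = 0%R.
    have -> : diffS (delta (Sub _ gA) - delta (Sub _ gB))%R =
        (diffS (delta (Sub _ gA)) - diffS (delta (Sub _ gB)))%R.
      exact: (raddfB (@Defs.diff _ e 2 k : {additive _ -> _})).
    apply/ffunP => t.
    by rewrite [LHS]ffunE [in X in (_ + X)%R]ffunE /= !diff_delta subrr ffunE.
  have := exact_zero _ dd.
  under eq_bigr => v _ do rewrite ffunE [X in (_ + X)%R]ffunE mulrBl.
  rewrite sumrB !sum_delta !weight_sum vA asboolT // asboolF ?subr0 // vB.
  by move=> /esym.
have dd : diffS (delta (Sub _ gA)) = 0%R.
  apply/ffunP => t; rewrite diff_delta ffunE insubN //=.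
  apply/negP; rewrite /is_generator /norm /= theadE (dist_ndist e_conn)
    /Defs.addo addn0.
  move=> /andP[_ /eqP[]]; have := ndist_le e_conn xB; rewrite Bz /k;
    rewrite /k in sB; lia.
by have := exact_zero _ dd; rewrite sum_delta weight_sum vA asboolT.
Qed.

End Halves.
End Step.

(** The walk [p] followed by the reverse of [q] is closed.  A closed walk of
    length [n > 4] is cut into halves of lengths [uphalf n] and [n - uphalf n],
    which act in the same way by [halves_contradiction]. *)
Theorem monodromy_unique x p q c : path e x p -> path e x q ->
  last x p = last x q ->
  fiber x c -> monodromy x p c = monodromy x q c.
Proof.
suff main n : forall x p q c, path e x p -> path e x q -> last x p = last x q ->
    size p + size q < n -> fiber x c -> monodromy x p c = monodromy x q c.
  by move=> xp xq pq gc; apply: (main (size p + size q).+1).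
elim: n => // n IH {}x {}p {}q {}c xp xq pq sn gc.
have loop y r d : path e y r -> last y r = y -> size r <= n -> fiber y d ->
  monodromy y r d = d.
  move=> yr ry; rewrite leq_eqVlt => /predU1P[rn|rn] gd; last first.
    by apply: (IH y r [::]); rewrite ?addn0.
  have [r4|r5] := leqP (size r) 4; first exact: short_loops.
  have r_n : 5 <= n by rewrite -rn.
  pose a := uphalf n; pose z := last y (take a r).
  have := yr; rewrite -{1}(cat_take_drop a r) cat_path => /andP[yA zB].
  have Blast : last z (drop a r) = y by rewrite /z -last_cat cat_take_drop.
  have sA : size (take a r) = a by rewrite size_take rn /a; case: ifP; lia.
  have sB : size (drop a r) = n - a by rewrite size_drop rn.
  pose B := rev (belast z (drop a r)).
  have yB : path e y B by have := rev_walk zB; rewrite Blast.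
  have Bz : last y B = z by have := last_rev_walk z (drop a r); rewrite Blast.
  have AB : monodromy y (take a r) d = monodromy y B d.
    apply: contrapT => neq.
    apply: (@halves_contradiction n r_n IH y z (take a r) B d) => //.
    - by rewrite size_rev size_belast sA sB; rewrite /a; lia.
    - by rewrite size_rev size_belast sA sB; rewrite /a; lia.
    - by rewrite size_rev size_belast sA sB; rewrite /a; lia.
  rewrite -(cat_take_drop a r) monodromy_cat AB -/z.
  have := @monodromy_rev z (drop a r) d zB; rewrite Blast; exact.
have := loop x (p ++ rev (belast x q)) c.
rewrite cat_path xp pq rev_walk // last_cat pq last_rev_walk size_cat size_rev
  size_belast.
move=> /(_ isT erefl); rewrite -ltnS => /(_ sn gc).
rewrite monodromy_cat pq => h.
rewrite -[in RHS]h monodromy_rev //.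
by rewrite -pq; apply: fiber_monodromy.
Qed.

End LocalSystem.

(** * The disc as a cell *)

Section Disc.
Context {R : realType}.
Local Notation disc := (@disc R).

Definition radius (z : R * R) : R := Num.sqrt (z.1 ^+ 2 + z.2 ^+ 2).

Lemma cont_radius : continuous radius.
Proof.
have cs := @sqrt_continuous R.
by rewrite /radius; apply: (cont_comp cs); cont.
Qed.

Lemma radius_ge0 z : 0 <= radius z. Proof. exact: sqrtr_ge0. Qed.

Lemma radiusZ (a : R) z : 0 <= a -> radius (a *: z) = a * radius z.
Proof.
move=> a0; rewrite /radius /= !exprMn -mulrDr sqrtrM ?sqr_ge0 //.
by rewrite sqrtr_sqr ger0_norm.
Qed.

Lemma radius_disc z : (radius z <= 1) = (z \in disc).
Proof.
apply/idP/idP => [z1|]; last rewrite inE /= => z1.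
  rewrite inE /disc /= -(@ler_sqrt _ _ 1) ?ltr01 // sqrtr1 //.
by rewrite /radius -sqrtr1 ler_sqrt ?ltr01.
Qed.

(** For [r = 1] this is the radial retraction onto the unit disc; for
    [r = 1 / 2] it sends the outer half of the disc to the circle. *)
Definition shrink (r : R) (z : R * R) : R * R := (Num.max r (radius z))^-1 *: z.

Lemma cont_shrink r : 0 < r -> continuous (shrink r).
Proof.
move=> r0; have cr := cont_radius; rewrite /shrink; apply: cont_scale;
  last exact: cont_id.
apply: cont_inv; last by cont.
by move=> z; rewrite gt_eqF // lt_max r0.
Qed.

Lemma shrink_le1 r z : 0 < r -> radius (shrink r z) <= 1.
Proof.
move=> r0; have m0 : 0 < Num.max r (radius z) by rewrite lt_max r0.
have m1 : 0 <= (Num.max r (radius z))^-1 by rewrite invr_ge0 ltW.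
rewrite /shrink (radiusZ _ m1) ler_pdivrMl // mulr1.
by rewrite le_max lexx orbT.
Qed.

Fact shrink_subproof r z : 0 < r -> shrink r z \in disc.
Proof. by move=> r0; rewrite -radius_disc shrink_le1. Qed.

Definition to_disc (z : R * R) : disc :=
  exist _ (shrink 1 z) (shrink_subproof z ltr01).

Lemma half_gt0 : 0 < 2^-1 :> R. Proof. by rewrite invr_gt0. Qed.

Definition stretch (d : disc) : disc := 
  exist _ (shrink 2^-1 (set_val d)) (shrink_subproof (set_val d) half_gt0).

Lemma cont_to_disc : continuous to_disc.
Proof. by apply: cont_subtype; rewrite set_valE /=; apply: cont_shrink. Qed.

Lemma cont_stretch : continuous stretch.
Proof.
apply: cont_subtype; rewrite set_valE /=.
by apply: (cont_comp (cont_shrink half_gt0)); exact: cont_set_val.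
Qed.

Lemma disc_radius (d : disc) : radius (set_val d) <= 1.
Proof. by rewrite radius_disc inE; exact: set_valP. Qed.

Lemma to_discK : cancel (set_val : disc -> R * R) to_disc.
Proof.
move=> d; apply/val_inj; rewrite /= /shrink max_l ?disc_radius //.
by rewrite invr1 scale1r set_valE.
Qed.

Lemma radius_circle t : radius (set_val (circle t : disc)) = 1.
Proof. by rewrite set_valE /radius /= cos2Dsin2 sqrtr1. Qed.

Lemma stretch_circle t : stretch (circle t) = circle t.
Proof.
apply/val_inj; rewrite /= /shrink radius_circle max_r; last by lra.
by rewrite invr1 scale1r set_valE.
Qed.

Definition rim : set disc := [set d | 2^-1 < radius (set_val d)].

Lemma open_rim : open rim.
Proof.
have c : continuous (fun d : disc => radius (set_val d)).
  by apply: (cont_comp cont_radius); exact: cont_set_val.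
by move/continuousP: c => /(_ _ (@open_gt _ 2^-1)).
Qed.

Lemma rim_circle t : rim (circle t).
Proof. by rewrite /rim /= radius_circle; lra. Qed.

(** By the double angle formula [sin (d / 2)] vanishes. *)
Lemma cos_eq1 (d : R) : 0 <= d -> d <= 2 * pi -> cos d = 1 ->
  d = 0 \/ d = 2 * pi.
Proof.
move=> d0 d2; have -> : d = (d / 2) *+ 2 by rewrite mulr2n; lra.
rewrite cos_mulr2n cos2sin2 => h.
have s0 : sin (d / 2) = 0 by apply/eqP; rewrite -sqrf_eq0; apply/eqP; lra.
have [->|dn0] := eqVneq d 0; first by left; rewrite mul0r mul0rn.
have [->|dn2] := eqVneq d (2 * pi); first by right; rewrite mulr2n; lra.
have : 0 < sin (d / 2).
  apply: sin_gt0_pi; have : 0 < d by rewrite lt_neqAle eq_sym dn0.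
  have : d < 2 * pi by rewrite lt_neqAle dn2.
  by move=> *; apply/andP; split; lra.
by rewrite s0 ltxx.
Qed.

Lemma circle_inj (a b : R) : 0 <= a -> a <= b -> b <= 1 ->
  circle (2 * pi * a) = circle (2 * pi * b) -> a = b \/ (a = 0 /\ b = 1).
Proof.
move=> a0 ab b1 /(congr1 val) /= [cab sab].
have pi0 := pi_gt0 R.
have : cos (2 * pi * b - 2 * pi * a) = 1 by rewrite cosB cab sab -!expr2
  cos2Dsin2.
have p0 : 0 <= 2 * pi * b - 2 * pi * a.
  by rewrite -mulrBr mulr_ge0 ?subr_ge0 //; lra.
have p1 : 2 * pi * b - 2 * pi * a <= 2 * pi.
  by rewrite -mulrBr -[leRHS]mulr1 ler_wpM2l //; lra.
move=> /(cos_eq1 p0 p1) [] h.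
- left; have : 2 * pi * (b - a) = 0 by rewrite mulrBr.
  move/eqP; rewrite mulf_eq0 => /orP[/eqP|/eqP]; lra.
- right; have : 2 * pi * (b - a - 1) = 0 by rewrite !mulrBr h; lra.
  move/eqP; rewrite mulf_eq0 => /orP[/eqP|/eqP h']; lra.
Qed.

Lemma circle_surj (x y : R) : x ^+ 2 + y ^+ 2 = 1 ->
  exists2 t, 0 <= t <= 1 & cos (2 * pi * t) = x /\ sin (2 * pi * t) = y.
Proof.
move=> xy; have pi0 := pi_gt0 R.
have x1 : -1 <= x <= 1.
  rewrite -ler_norml -(@expr_le1 _ 2) // real_normK ?num_real //.
  by have := sqr_ge0 y; lra.
have y2 : 1 - x ^+ 2 = y ^+ 2 by rewrite -xy; ring.
have ca : cos (acos x) = x by apply: acosK; rewrite in_itv.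
have sa : sin (acos x) = `|y| by rewrite sin_acos // y2 sqrtr_sqr.
have a0 := acos_ge0 x1; have api := acos_lepi x1.
have e (u : R) : 2 * pi * (u / (2 * pi)) = u.
  by rewrite mulrC mulfVK // mulf_neq0 // gt_eqF.
have b (u : R) : 0 <= u -> u <= 2 * pi -> 0 <= u / (2 * pi) <= 1.
  move=> u0 u1; rewrite divr_ge0 //=; last by lra.
  by rewrite ler_pdivrMr ?mul1r //; lra.
have [y0|y0] := leP 0 y.
  exists (acos x / (2 * pi)); first by apply: b => //; lra.
  by rewrite e ca sa ger0_norm.
exists ((pi *+ 2 - acos x) / (2 * pi)); first by apply: b; rewrite mulr2n; lra.
rewrite e -[_ - _]addrC sinD2pi cosD2pi cosN sinN ca sa ltr0_norm //.
by rewrite opprK.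
Qed.

Lemma split_turn n (t : R) : (0 < n)%N -> 0 <= t <= 1 ->
  exists k : 'I_n, exists2 s, 0 <= s <= 1 & t = (k%:R + s) / n%:R.
Proof.
move=> n0 /andP[t0 t1]; have nR : 0 < n%:R :> R by rewrite ltr0n.
have e u : t * n%:R = u -> t = u / n%:R by move=> <-; rewrite mulfK // gt_eqF.
have [t1'|tn] := ltP t 1; last first.
  have kn : (n.-1 < n)%N by rewrite prednK.
  exists (Ordinal kn), 1; first by rewrite ler01 lexx.
  apply: e; rewrite /= natr1 prednK // (_ : t = 1) ?mul1r //; lra.
have tn0 : 0 <= t * n%:R by rewrite mulr_ge0 // ltW.
have /andP[k1 k2] := truncn_itv tn0.
have kn : (Num.truncn (t * n%:R) < n)%N.
  by rewrite -(ltr_nat R) (le_lt_trans k1) // -[ltRHS]mul1r ltr_pM2r.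
exists (Ordinal kn), (t * n%:R - (Num.truncn (t * n%:R))%:R) => /=.
  by move: k2; rewrite -natr1 => k2; apply/andP; split; lra.
by apply: e; lra.
Qed.

Lemma rim_stretch n (d : disc) : (0 < n)%N -> rim d ->
  exists k : 'I_n, exists s : unit_interval R,
    circle (2 * pi * ((k%:R + val s) / n%:R)) = stretch d.
Proof.
move=> n0 rd; rewrite /rim /= in rd.
have rS : radius (set_val (stretch d)) = 1.
  rewrite set_valE /= radiusZ ?invr_ge0 ?le_max ?radius_ge0 ?orbT //.
  by rewrite max_r ?mulVf // ?gt_eqF //; lra.
have : (set_val (stretch d)).1 ^+ 2 + (set_val (stretch d)).2 ^+ 2 = 1.
  move: rS => /(congr1 (fun u => u ^+ 2)); rewrite expr1n sqr_sqrtr //.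
  by rewrite addr_ge0 ?sqr_ge0.
case/circle_surj => t t01 [ct st].
have [k [s s01 ts]] := split_turn n0 t01.
exists k, (to_interval s); apply/val_inj; rewrite /= clamp_id;
  [|by case/andP: s01..].
by rewrite -ts ct st set_valE -surjective_pairing.
Qed.

End Disc.

(** * Cells of the complex *)

Section Graph.
Context (R : realType) (T : finType) (e : rel T).
Context (e_irr : irreflexive e) (e_sym : symmetric e).

Local Notation G := (realization R e).
Local Notation Z := (CW2 R e).
Local Notation vertex := (@realization_vertex R T e).
Local Notation seg := (@segment R T e).
Local Notation redge := (@realization_edge R T e).

Definition skeleton (q : G) : Z := attach_base _ _ q.
Definition disc_cell (c : faces e) (d : @disc R : Type) : Z :=
  attach_cell _ _ c d.

Lemma cont_skeleton : continuous skeleton.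
Proof. exact: cont_base. Qed.

Lemma cont_redge a : continuous (redge a).
Proof. exact: cont_cell. Qed.

Lemma edge_zero (a : edge e) : redge a zero = vertex (val a).1.
Proof. exact: (@cell_bd _ _ _ _ _ _ a false). Qed.

Lemma edge_one (a : edge e) : redge a one = vertex (val a).2.
Proof. exact: (@cell_bd _ _ _ _ _ _ a true). Qed.

Lemma segment_edge (a : edge e) : seg (val a).1 (val a).2 = redge a.
Proof. by apply/funext => s; rewrite /segment -surjective_pairing valK. Qed.

Lemma segment_edge_rev (a : edge e) s :
  seg (val a).2 (val a).1 s = redge a (reverse s).
Proof.
rewrite /segment insubN; first by rewrite -surjective_pairing valK.
by rewrite /= negb_and -leqNgt; have /andP[_ /ltnW ->] := valP a; rewrite orbT.
Qed.

Lemma edge_cases x y : e x y ->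
  exists a : edge e, val a = (x, y) \/ val a = (y, x).
Proof.
move=> xy; have xny : x != y by apply: contraTneq xy => ->; rewrite e_irr.
have [lt_xy|lt_yx|eq_xy] := ltngtP (enum_rank x) (enum_rank y).
- have h : e (x, y).1 (x, y).2 && (enum_rank (x, y).1 < enum_rank (x, y).2)%N.
    by rewrite /= xy lt_xy.
  by exists (Sub (x, y) h); left.
- have h : e (y, x).1 (y, x).2 && (enum_rank (y, x).1 < enum_rank (y, x).2)%N.
    by rewrite /= e_sym xy lt_yx.
  by exists (Sub (y, x) h); right.
- by case/eqP: xny; apply: enum_rank_inj; apply/val_inj.
Qed.

Lemma segment_rev x y s : e x y -> seg y x (reverse s) = seg x y s.
Proof.
case/edge_cases => a [] va.
- by have := segment_edge a; have := segment_edge_rev a (reverse s);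
    rewrite va /= => -> ->; rewrite reverseK.
- by have := segment_edge a; have := segment_edge_rev a s;
    rewrite va /= => -> ->.
Qed.

Lemma segment_zero x y : e x y -> seg x y zero = vertex x.
Proof.
case/edge_cases => a [] va.
- by have := segment_edge a; have := edge_zero a; rewrite va /= => <- ->.
- by have := segment_edge_rev a zero; have := edge_one a;
    rewrite va /= reverse_zero => <- ->.
Qed.

Lemma segment_one x y : e x y -> seg x y one = vertex y.
Proof.
by move=> xy; rewrite -segment_rev // reverse_one segment_zero // e_sym.
Qed.

Lemma cont_segment x y : continuous (seg x y).
Proof.
rewrite /segment; case: insubP => [a _ _|_]; first exact: cont_redge.
case: insubP => [a _ _|_]; last exact: cont_cst.
by apply: (@cont_comp _ _ _ (@reverse R) (redge a));
  [exact: cont_redge|exact: cont_reverse].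
Qed.

Definition edge_path (x y : T) (s : R) : Z :=
  skeleton (seg x y (to_interval s)).

Lemma cont_edge_path x y : continuous (edge_path x y).
Proof.
apply: (cont_comp cont_skeleton); apply: (cont_comp (@cont_segment x y)).
exact: cont_to_interval.
Qed.

Lemma edge_path0 x y : e x y -> edge_path x y 0 = skeleton (vertex x).
Proof. by move=> xy; rewrite /edge_path to_interval0 segment_zero. Qed.

Lemma edge_path1 x y : e x y -> edge_path x y 1 = skeleton (vertex y).
Proof. by move=> xy; rewrite /edge_path to_interval1 segment_one. Qed.

Lemma edge_path_rev x y s : e x y -> edge_path y x (1 - s) = edge_path x y s.
Proof. by move=> xy; rewrite /edge_path to_interval_reverse segment_rev. Qed.

Section Faces.
Context (c : faces e).
Local Notation s := (val c).
Local Notation n := (size (val c)).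

Lemma face_size : (0 < n)%N.
Proof. by have /and3P[/orP[] /eqP-> _ _] := valP c. Qed.

Lemma face_uniq : uniq s.
Proof. by have /and3P[_ /andP[_ ->] _] := valP c. Qed.

Lemma face_cycle : cycle e s.
Proof. by have /and3P[_ /andP[-> _] _] := valP c. Qed.

Lemma face_glue (k : 'I_n) (t : unit_interval R) :
  disc_cell c (circle (2 * pi * ((k%:R + val t) / n%:R))) =
  skeleton (seg (tnth (in_tuple s) k) (tnth (in_tuple s) (ordS k)) t).
Proof.
exact: (@cell_bd _ _ _ _ _ _ c (k, t)).
Qed.

(** The point of the circle glued to the vertex [u] of the face. *)
Definition corner (u : T) : R * R :=
  set_val (circle (2 * pi * ((index u s)%:R / n%:R)) : (@disc R : Type)).

Lemma circle_turn : circle (2 * pi * 1) = circle 0 :> (@disc R : Type).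
Proof.
apply/val_inj; rewrite /= mulr1 (_ : 2 * pi = pi *+ 2) ?cos2pi ?sin2pi ?cos0
  ?sin0 //.
by rewrite mulr_natl.
Qed.

Lemma index_next u : u \in s -> index (next s u) s = ((index u s).+1 %% n)%N.
Proof.
move=> us; have := us; rewrite -index_mem => ui.
have us' := face_uniq; rewrite next_nth us;
  case E: s us us' ui => [//|y p] us us' ui.
set i := index u (y :: p) in ui *.
have [ip|pi] := ltnP i (size p).
  rewrite (_ : nth y p i = nth y (y :: p) i.+1) // modn_small ?ltnS //.
  by rewrite index_uniq.
have -> : i.+1 = size (y :: p) by apply/eqP; rewrite eqn_leq ui /= ltnS.
by rewrite modnn nth_default //= eqxx.
Qed.

Lemma tnth_index u (us : u \in s) (ui : (index u s < n)%N) :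
  tnth (in_tuple s) (Ordinal ui) = u /\ tnth (in_tuple s) (ordS (Ordinal ui)) =
    next s u.
Proof.
split; first by rewrite (tnth_nth u) /= nth_index.
rewrite (tnth_nth u) /= -index_next // nth_index //.
by rewrite mem_next.
Qed.

(** An edge of the face is glued to an arc of the circle, so that going along
    it is a way to go from one corner to the next one inside the disc. *)
Lemma face_transport z0 u v al be : u \in s -> next s u = v ->
  transport z0 (edge_path u v : R^o -> Z) 0 1 al be ->
  transport z0 (fun z => disc_cell c (to_disc z)) (corner u) (corner v) al be.
Proof.
move=> us uv tr; have ui : (index u s < n)%N by rewrite index_mem.
have [tu tv] := tnth_index us ui.
have nR : n%:R != 0 :> R by rewrite pnatr_eq0 -lt0n face_size.
pose g (t : R) : R * R := set_val
  (circle (2 * pi * (((index u s)%:R + clamp 0 1 t) / n%:R)) : (@disc R :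
    Type)).
have cg : continuous g.
  rewrite /g set_valE /=; have cc := @continuous_cos R;
    have cs := @continuous_sin R; cont.
have g0 : g 0 = corner u by rewrite /g clamp_id // addr0.
have g1 : g 1 = corner v.
  rewrite /g clamp_id // /corner -uv index_next //.
  have [lt|ge] := ltnP (index u s).+1 n; first by rewrite modn_small // natr1.
  have -> : (index u s).+1 = n by apply/eqP; rewrite eqn_leq ui.
  have e1 : ((index u s)%:R + 1) / n%:R = 1 :> R.
    by rewrite natr1 (_ : (index u s).+1 = n) ?divff //; apply/eqP;
      rewrite eqn_leq ui.
  by rewrite modnn mul0r mulr0 e1 circle_turn.
rewrite -g0 -g1; apply: (transport_map cg) tr => t.
have := face_glue (Ordinal ui) (to_interval t).
by rewrite /g to_discK tu tv uv.
Qed.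

Lemma corner_vertex u : u \in s ->
  disc_cell c (to_disc (corner u)) = skeleton (vertex u).
Proof.
move=> us; have ui : (index u s < n)%N by rewrite index_mem.
have [tu tv] := tnth_index us ui.
have := face_glue (Ordinal ui) zero; rewrite tu tv /= addr0 /corner to_discK =>
  ->.
by rewrite segment_zero //; exact: next_cycle face_cycle us.
Qed.

End Faces.

End Graph.

(** * The local system of homotopy classes *)

Section Representative.
Context (T : finType) (e : rel T) (e_sym : symmetric e).

Definition side (c : seq T) (u v : T) : bool :=
  [&& u \in c, v \in c & (next c u == v) || (next c v == u)].

Lemma side_rot i (c : seq T) : uniq c -> side (rot i c) =2 side c.
Proof. by move=> uc u v; rewrite /side !mem_rot !next_rot. Qed.

Lemma side_rev (c : seq T) : uniq c -> side (rev c) =2 side c.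
Proof.
move=> uc u v; rewrite /side !mem_rev !(next_rev uc).
case uc' : (u \in c) => //=; case vc' : (v \in c) => //=.
apply/orP/orP => -[] /eqP <-; [right|left|right|left]; apply/eqP.
- exact: next_prev.
- exact: next_prev.
- exact: prev_next.
- exact: prev_next.
Qed.

Lemma cycle_rev (c : seq T) : cycle e (rev c) = cycle e c.
Proof.
rewrite rev_cycle; case: c => //= x p; apply: eq_path => y z; exact: e_sym.
Qed.

(** A cycle becomes the representative of its class after a rotation that
    brings its least vertex to the front, and possibly a reflection. *)
Lemma face_exists (c : seq T) : (size c == 3%N) || (size c == 4%N) ->
  uniq c -> cycle e c -> exists f : faces e, side (val f) =2 side c.
Proof.
move=> sc uc cc.
have [x xc] : exists x, x \in c by case: c sc {uc cc} => // x p _; exists x;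
  rewrite mem_head.
case: (arg_minnP (P := fun y => y \in c) enum_rank xc) => m mc mmin.
have [i q eq_q] := rot_to mc.
have uq : uniq (m :: q) by rewrite -eq_q rot_uniq.
have cq : cycle e (m :: q) by rewrite -eq_q rot_cycle.
have sq : (size (m :: q) == 3%N) || (size (m :: q) == 4%N) by rewrite -eq_q
  size_rot.
have sideq : side (m :: q) =2 side c by move=> u v; rewrite -eq_q side_rot.
have minq : all (fun y => enum_rank m < enum_rank y)%N q.
  apply/allP => y yq; rewrite ltn_neqAle mmin; last first.
    by rewrite -(mem_rot i) eq_q inE yq orbT.
  rewrite andbT; apply: contraTneq yq => /val_inj /enum_rank_inj <-.
  by case/andP: uq.
have [lt|ge] := ltnP (enum_rank (head m q)) (enum_rank (last m q)).
  have h : is_face e (m :: q) by rewrite /is_face sq /ucycleb cq uq minq.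
  by exists (Sub (m :: q) h).
have q_ne : head m q != last m q.
  case: q sq uq {eq_q cq sideq minq ge} => [|y [|z q]] //= _ /and3P[_ yq _].
  by apply: contraNneq yq => ->; exact: mem_last.
have rotq : m :: rev q = rotr 1 (rev (m :: q)) by rewrite rev_cons rotr1_rcons.
have ucr : ucycleb e (m :: rev q).
  by rewrite /ucycleb rotq rotr_cycle cycle_rev cq rotr_uniq rev_uniq uq.
have h : is_face e (m :: rev q).
  rewrite /is_face /= size_rev -/(size (m :: q)) sq all_rev minq.
  rewrite ucr /=.
  case: q {eq_q cq mc uq sq sideq minq rotq ucr} q_ne ge => [|y q] //=;
    first by rewrite eqxx.
  move=> q_ne ge; rewrite rev_cons last_rcons.
  have -> : head m (rcons (rev q) y) = last y q.
    by case/lastP: q {q_ne ge} => //= q z; rewrite rev_rcons last_rcons.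
  rewrite ltn_neqAle ge andbT; apply: contra q_ne =>
    /eqP/val_inj/enum_rank_inj ->.
  exact: eqxx.
exists (Sub (m :: rev q) h) => u v.
by rewrite SubK rotq /rotr side_rot ?rev_uniq // side_rev.
Qed.

End Representative.

Section Monodromy.
Context (R : realType) (T : finType) (e : rel T).
Context (e_irr : irreflexive e) (e_sym : symmetric e).
Context (z0 : CW2 R e).

Local Notation Z := (CW2 R e).
Local Notation vpoint v := (skeleton (@realization_vertex R T e v)).
Local Notation edge_path := (@edge_path R T e).

Definition edge_transport x y (al be : R -> Z) : Prop :=
  transport z0 (edge_path x y : R^o -> Z) 0 1 al be.

Lemma edge_transport_sym x y al be : e x y -> edge_transport x y al be ->
  edge_transport y x be al.
Proof.
move=> xy /transport_sym tr.
have := @transport_map _ _ z0 R^o R^o (edge_path x y) (edge_path y x)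
  (fun s => 1 - s) _ _ _ _ _ _ tr.
rewrite subrr subr0; apply; first by cont.
by move=> s; exact: edge_path_rev.
Qed.

Lemma edge_transport_exists x y al : e x y -> based_path z0 al ->
  al 1 = vpoint x ->
  exists be, [/\ based_path z0 be, be 1 = vpoint y & edge_transport x y al be].
Proof.
move=> xy [cal al0] al1.
have al_e : al 1 = edge_path x y 0 by rewrite al1 edge_path0.
exists (path_cat al (edge_path x y)); split.
- split; last by rewrite path_cat0.
  by apply: path_cat_cont => //; exact: cont_edge_path.
- by rewrite path_cat1 edge_path1.
- exists id; split=> //; first exact: cont_id.
  by apply: square_extend => //; exact: cont_edge_path.
Qed.

Lemma edge_transport_end x y al be : e x y -> edge_transport x y al be ->
  be 1 = vpoint y.
Proof. by move=> xy /transport_end[_ ->]; rewrite edge_path1. Qed.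

Lemma edge_transport_homotopic x y al al' be : e x y -> al 1 = vpoint x ->
  homotopic z0 al al' -> edge_transport x y al' be -> edge_transport x y al be.
Proof.
move=> xy al1 h; apply: transport_trans; apply: homotopic_transport h.
by rewrite edge_path0.
Qed.

(** Going back along the edge and then forth is a loop in the line. *)
Lemma edge_transport_unique x y al be be' : e x y -> based_path z0 be ->
  based_path z0 be' ->
  edge_transport x y al be -> edge_transport x y al be' -> homotopic z0 be be'.
Proof.
move=> xy gb gb' tr tr'; apply:
  (transport_loop (F := edge_path x y : R^o -> Z) (u := 1)) => //.
  exact: cont_edge_path.
by apply: transport_trans tr'; exact: transport_sym.
Qed.

(** Homotopy classes are sets of paths, so that monodromy around a closed walk
    can be compared with the identity by an equality. *)
Definition homotopy_class (al : R -> Z) : set (R -> Z) :=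
  [set be | based_path z0 be /\ homotopic z0 al be].

Lemma homotopy_class_eq al be : homotopic z0 al be ->
  homotopy_class al = homotopy_class be.
Proof.
move=> h; apply/seteqP; split=> ga [gg hg]; split=> //.
  exact: (homotopic_trans (homotopic_sym h)).
exact: homotopic_trans hg.
Qed.

Definition class_at (x : T) (C : set (R -> Z)) : Prop :=
  exists al, [/\ based_path z0 al, al 1 = vpoint x & C = homotopy_class al].

Definition push (x y : T) (C : set (R -> Z)) : set (R -> Z) :=
  [set be | based_path z0 be /\ exists2 al, C al & edge_transport x y al be].

Lemma push_homotopy_class x y al be : e x y -> based_path z0 al ->
  al 1 = vpoint x ->
  based_path z0 be -> edge_transport x y al be ->
    push x y (homotopy_class al) = homotopy_class be.
Proof.
move=> xy gal al1 gbe ab; apply/seteqP; split=> de [gde].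
  case=> al' [gal' h] ad; split=> //.
  by apply: (edge_transport_unique xy gbe gde ab);
    exact: edge_transport_homotopic h ad.
move=> h; split=> //; exists al; first by split=> //; exact: homotopic_refl.
apply: (transport_trans ab); apply: homotopic_transport h.
by rewrite (edge_transport_end xy ab) edge_path1.
Qed.

Lemma class_push x y C : e x y -> class_at x C -> class_at y (push x y C).
Proof.
move=> xy [al [gal al1 ->]]; have [be [gbe be1 ab]] :=
  edge_transport_exists xy gal al1.
by exists be; split=> //; exact: push_homotopy_class.
Qed.

Lemma push_push x y C : e x y -> class_at x C -> push y x (push x y C) = C.
Proof.
move=> xy [al [gal al1 ->]]; have [be [gbe be1 ab]] :=
  edge_transport_exists xy gal al1.
rewrite (push_homotopy_class xy gal al1 gbe ab)
  (push_homotopy_class _ gbe be1 gal) //.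
  by rewrite e_sym.
exact: edge_transport_sym.
Qed.

Lemma edge_transport_face (c : faces e) x y al be : e x y -> side (val c) x y ->
  edge_transport x y al be ->
  transport z0 (fun z => disc_cell c (to_disc z)) (corner R c x) (corner R c y)
    al be.
Proof.
move=> xy /and3P[xc yc /orP[/eqP n|/eqP n]] ab.
  exact: (face_transport xc).
by apply/transport_sym/(face_transport yc n); exact: edge_transport_sym.
Qed.

(** While a walk turns around a face, it acts by transport in the disc. *)
Lemma monodromy_face (c : faces e) x p al : path e x p ->
  path (side (val c)) x p ->
  based_path z0 al -> al 1 = vpoint x -> x \in val c ->
  exists be, [/\ based_path z0 be, be 1 = vpoint (last x p),
    monodromy push x p (homotopy_class al) = homotopy_class be &
    transport z0 (fun z => disc_cell c (to_disc z))
      (corner R c x) (corner R c (last x p)) al be].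
Proof.
elim: p x al => [|y p IH] x al /=.
  move=> _ _ gal al1 xc; exists al; split=> //.
  apply: homotopic_transport; last exact: homotopic_refl.
  by rewrite (@corner_vertex R T e e_irr e_sym).
move=> /andP[xy yp] /andP[sxy syp] gal al1 xc.
have [be [gbe be1 ab]] := edge_transport_exists xy gal al1.
have yc : y \in val c by case/and3P: sxy.
have [de [gde de1 tde bd]] := IH y be yp syp gbe be1 yc.
exists de; split=> //; first by rewrite (push_homotopy_class xy gal al1 gbe ab).
exact: transport_trans (edge_transport_face xy sxy ab) bd.
Qed.

Lemma cont_disc_cell (c : faces e) :
  continuous (fun z : R * R => disc_cell c (to_disc z)).
Proof.
apply: (@cont_comp _ _ _ (@to_disc R) (disc_cell c)); last exact: cont_to_disc.
exact: cont_cell.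
Qed.

Lemma monodromy_cycle x p C : (size p == 2)%N || (size p == 3)%N ->
  uniq (x :: p) ->
  path e x (rcons p x) -> class_at x C -> monodromy push x (rcons p x) C = C.
Proof.
move=> sp up ep [al [gal al1 ->]].
have [c sc] := face_exists e_sym (c := x :: p) sp up ep.
have xc : x \in x :: p by exact: mem_head.
have xp : path (side (val c)) x (rcons p x).
  rewrite (eq_path sc); have := cycle_next up.
  have : all (mem (x :: p)) (x :: p) by apply/allP.
  move=> al_xp; apply: (sub_in_cycle (P := mem (x :: p))) al_xp =>
    u v uc vc /eqP uv.
  by rewrite /side uc vc uv eqxx.
have xcc : x \in val c.
  have : side (val c) x (next (x :: p) x).
    by rewrite sc /side mem_next xc eqxx.
  by case/and3P.
have [be [gbe _ -> tr]] := monodromy_face ep xp gal al1 xcc.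
rewrite last_rcons in tr; apply/esym/homotopy_class_eq.
exact: (transport_loop (@cont_disc_cell c)) tr.
Qed.

(** Four consecutive distinct vertices, or three, bound a face; all other short
    closed walks backtrack. *)
Lemma monodromy_small x p C : path e x p -> last x p = x -> (size p <= 4)%N ->
  class_at x C -> monodromy push x p C = C.
Proof.
have ne u v : e u v -> u != v by apply: contraTneq => ->; rewrite e_irr.
case: p => [|y [|z [|w [|v [|u p]]]]] //=.
- by move=> /andP[/ne/eqP xy _] yx; case: xy.
- by move=> /and3P[xy yz _] zx _ gC; rewrite zx; exact: push_push.
- move=> ep wx _ gC; have := ep; rewrite {}wx in ep * => /and4P[xy yz zx _].
  apply: (@monodromy_cycle x [:: y; z]) => //.
  by rewrite /= !inE !negb_or (ne _ _ xy) (ne _ _ yz) eq_sym (ne _ _ zx).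
- move=> ep vx _ gC; have := ep; rewrite {}vx in ep * => /and5P[xy yz zw wx _].
  have gy := class_push xy gC.
  have [xz|xz] := eqVneq x z.
    subst z; rewrite [push y x _]push_push //; exact: push_push.
  have [yw|yw] := eqVneq y w.
    by subst w; rewrite [push z y _]push_push //; exact: push_push.
  apply: (@monodromy_cycle x [:: y; z; w]) => //.
  rewrite /= !inE !negb_or (ne _ _ xy) (ne _ _ yz) (ne _ _ zw) xz yw /=.
  by rewrite eq_sym (ne _ _ wx).
Qed.

End Monodromy.

(** * Simple connectedness *)

Lemma discrete_path_cst (R : realType) (U : discreteTopologicalType)
  (p : R -> U) (a b : R) :
  continuous p -> a <= b -> forall s, a <= s -> s <= b -> p s = p a.
Proof.
move=> cp ab.
apply: (@nbhs_induction _ (fun x y => forall s, x <= s -> s <= y -> p s = p x))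
  => //.
  move=> x y z _ xy yz _ pxy pyz s xs sz; have [sy|ys] := leP s y;
    first exact: pxy.
  by rewrite (pyz s) ?(pxy y) // ltW.
move=> s _ _; exists (p @^-1` [set p s]).
  by apply: cp; rewrite nbhs_principalE /principal_filter /=;
    apply/principal_filterP.
move=> x y _ xy _ N u xu uy.
by rewrite (N x) //; exact: (N u).
Qed.

Section VertexSystem.
Context (R : realType) (T : finType) (e : rel T).
Context (e_irr : irreflexive e) (e_sym : symmetric e).
Context (e_conn : forall x y : T, connect e x y).
Context (MH2_eq0 : forall k : nat, (2 < k)%N -> forall h : MH e 2 k, h = 0).
Context (x0 : T).

Local Notation vpoint v := (@skeleton R T e (@realization_vertex R T e v)).
Local Notation z0 := (vpoint x0).

(** Push the class of the constant path at [x0] along any walk from [x0] to [v],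
    and choose a path in the resulting class.  Since the walk does not matter,
    these classes are compatible with the edges. *)
Lemma vertex_paths : exists g : T -> R -> CW2 R e,
  (forall v, based_path z0 (g v) /\ g v 1 = vpoint v) /\
  (forall u v, e u v -> edge_transport z0 u v (g u) (g v)).
Proof.
pose C0 := homotopy_class z0 (fun=> z0).
pose C v := monodromy (push z0) x0 (geodesic e_conn x0 v) C0.
have gC0 : class_at z0 x0 C0.
  by exists (fun=> z0); split=> //; split=> //; exact: cont_cst.
have gC v : class_at z0 v (C v).
  rewrite -[X in class_at _ X _](geodesic_last e_conn x0 v).
  apply: (fiber_monodromy (e := e)) => //; last exact: geodesic_path.
  by move=> x y c xy; apply: class_push.
have CE u v : e u v -> push z0 u v (C u) = C v.
  move=> uv; rewrite /C -{1}(geodesic_last e_conn x0 u) -monodromy_rcons.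
  apply: (monodromy_unique e_irr e_sym e_conn MH2_eq0 (fiber := class_at z0)) =>
    //.
  - by move=> x y c xy; apply: class_push.
  - by move=> x p c; apply: monodromy_small.
  - by rewrite rcons_path geodesic_path geodesic_last.
  - exact: geodesic_path.
  - by rewrite last_rcons geodesic_last.
have [g gP] := choice gC; exists g; split=> [v|u v uv].
  by have [ga g1 _] := gP v.
have [gu gu1 Cu] := gP u; have [gv gv1 Cv] := gP v.
have : C v (g v) by rewrite Cv; split=> //; exact: homotopic_refl.
rewrite -(CE _ _ uv) Cu => -[_ [al [gal hal] al_v]].
exact: edge_transport_homotopic hal al_v.
Qed.

Section Systems.
Context (g : T -> R -> CW2 R e).
Hypothesis gP : forall v, based_path z0 (g v) /\ g v 1 = vpoint v.
Hypothesis g_edge : forall u v, e u v -> edge_transport z0 u v (g u) (g v).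

Lemma vertex_system : path_system z0
  (fun v : discrete_topology T => vpoint v) g.
Proof.
split=> [v|v|v|p a b cp ab]; try by have [[]] := gP v.
have pE := discrete_path_cst cp ab.
rewrite (pE b) //; apply:
  (@eq_square _ _ z0 a b (fun=> vpoint (p a)) _ (g (p a)) _ (g (p a))) => //.
  by move=> s as_ sb; rewrite pE.
by have [[ca a0] a1] := gP (p a); exact: square_cst.
Qed.

Local Notation edge_end :=
  (fun (_ : edge e) (b : bool) => if b then one else zero : unit_interval R).

Lemma skeleton_system : exists h : realization R e -> R -> CW2 R e,
  path_system z0 (@skeleton R T e) h.
Proof.
have cv := @cont_set_val R `[0, 1]%classic.
have cti := @cont_to_interval R.
(* This map sends [0, 1/4] to 0 and [3/4, 1] to 1, and [O] is the set of the
   [d] with d < 1/4 or d > 3/4. *)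
pose rho (d : unit_interval R) := to_interval (2 * set_val d - 2^-1).
pose O : set (unit_interval R) :=
  [set d | 0 < (set_val d - 4^-1) * (set_val d - 3 / 4)].
have crho : continuous rho.
  by apply: (cont_comp cti); apply: cont_add; [apply: cont_mul|]; cont.
have rho_hi d : 3 / 4 <= set_val d -> rho d = one.
  move=> d4; rewrite -to_interval1 /rho; apply/val_inj => /=.
  by rewrite !clamp_hi //; lra.
have rho_lo d : set_val d <= 4^-1 -> rho d = zero.
  move=> d4; rewrite -to_interval0 /rho; apply/val_inj => /=.
  by rewrite !clamp_lo //; lra.
have oO : open O.
  have c : continuous
    (fun d : unit_interval R => (set_val d - 4^-1) * (set_val d - 3 / 4)).
    by apply: cont_mul; apply: cont_add; cont.
  by move/continuousP: c => /(_ _ (@open_gt _ 0)).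
have rho_bd (i : edge e) (b : bool) : rho (edge_end i b) = edge_end i b.
  by case: b; [apply: rho_hi; rewrite interval_val1|apply: rho_lo;
    rewrite interval_val0]; lra.
have O_bd (i : edge e) (b : bool) : O (edge_end i b).
  by rewrite /O /=; case: b; rewrite ?interval_val1 ?interval_val0; lra.
have rho_O (i : edge e) d : O d -> range (edge_end i) (rho d).
  rewrite /O /= => Od; have [d4|d4] := leP (set_val d) 4^-1.
    by exists false => //; rewrite rho_lo.
  by exists true => //; rewrite rho_hi //; nra.
have closed_bd (i : edge e) (A : set bool) : closed (edge_end i @` A).
  apply: compact_subtype_closed; apply: finite_compact.
  exact/finite_image/finite_finset.
have phi_bd (i : edge e) (b b' : bool) : edge_end i b = edge_end i b' ->
    (if b then (val i).2 else (val i).1) =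
      (if b' then (val i).2 else (val i).1).
  by case: b; case: b' => //= /(congr1 set_val) /eqP;
     rewrite interval_val0 interval_val1 ?oner_eq0 // eq_sym oner_eq0.
have S := attach_system (X := discrete_topology T) phi_bd (V := R^o)
  (fun=> false)
  cv cti (@to_intervalK R) crho oO rho_bd O_bd rho_O
    (fun i C _ => closed_bd i _)
  (f := @skeleton R T e) (@cont_skeleton R T e) vertex_system.
eexists; apply: S => i b b'.
have uv : e (val i).1 (val i).2 by have /andP[] := valP i.
have tr : transport z0
  (fun v : R^o => skeleton (realization_edge i (to_interval v)))
    0 1 (g (val i).1) (g (val i).2).
  have := g_edge uv; rewrite /edge_transport.
  by under [X in transport _ X]eq_fun do rewrite /edge_path segment_edge.
have [[gu gu1] [gv gv1]] := (gP (val i).1, gP (val i).2).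
have [tr0 tr1] := transport_end tr.
case: b; case: b' => //=; rewrite ?interval_val0 ?interval_val1 //.
- by apply: homotopic_transport; [rewrite tr1|exact: homotopic_refl].
- exact: transport_sym.
- by apply: homotopic_transport; [rewrite tr0|exact: homotopic_refl].
Qed.

End Systems.

Section Boundary.
Context (c : faces e).
Local Notation n := (size (val c)).
Local Notation corner_at := (tnth (in_tuple (val c))).

Definition boundary_disc (b : 'I_n * unit_interval R) : (@disc R : Type) :=
  circle (2 * pi * ((b.1%:R + val b.2) / n%:R)).

Definition boundary_map (b : 'I_n * unit_interval R) : realization R e :=
  segment e (corner_at b.1) (corner_at (ordS b.1)) b.2.

Lemma boundary_edge (k : 'I_n) : e (corner_at k) (corner_at (ordS k)).
Proof.
set u := corner_at k.
have us : u \in val c by exact: mem_tnth.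
have ik : index u (val c) = k by rewrite /u (tnth_nth u) index_uniq ?face_uniq.
have ui : (index u (val c) < n)%N by rewrite index_mem.
have [_] := tnth_index us ui; rewrite (_ : Ordinal ui = k); last exact: val_inj.
by move=> ->; exact: next_cycle (face_cycle c) us.
Qed.

Lemma boundary_map0 k : boundary_map (k, zero) = realization_vertex R e
  (corner_at k).
Proof. by rewrite /boundary_map /= segment_zero ?boundary_edge. Qed.

Lemma boundary_map1 k : boundary_map (k, one) = realization_vertex R e
  (corner_at (ordS k)).
Proof. by rewrite /boundary_map /= segment_one ?boundary_edge. Qed.

(** Each corner has two parameters: it ends one arc and starts the next. *)
Lemma boundary_map_turn (k k' : 'I_n) (t t' : unit_interval R) :
  k%:R + val t = k'%:R + val t' -> boundary_map (k, t) = boundary_map (k', t').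
Proof.
wlog kk' : k k' t t' / (k <= k')%N => [H|].
  by move=> tt'; have [|/ltnW] := leqP k k' => h; [|apply/esym]; exact: H.
have := interval_itv t; have := interval_itv t';
  rewrite !set_valE => /andP[t'0 t'1] /andP[t0 t1].
move: kk'; rewrite leq_eqVlt => /predU1P[/val_inj <-|lt_kk'] tt'.
  by congr (boundary_map (_, _)); apply/val_inj/(addrI (k%:R : R)).
have : (k.+1%:R : R) <= k'%:R by rewrite ler_nat.
rewrite -natr1 => kk1.
have -> : t = one by apply: interval_eq1; lra.
have t'z : t' = zero by apply: interval_eq0; lra.
rewrite t'z boundary_map1 boundary_map0;
  congr (realization_vertex _ _ (corner_at _)).
apply/val_inj => /=; have k'E : k'%:R = k.+1%:R :> R.
  have v0 : val t' = 0 :> R by rewrite t'z.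
  by rewrite -(natr1 k); move: tt'; rewrite v0; lra.
have {}k'E : k' = k.+1 :> nat by apply/eqP; rewrite -(eqr_nat R) k'E.
by rewrite -k'E modn_small.
Qed.

Lemma boundary_map_bd b b' : boundary_disc b = boundary_disc b' ->
  boundary_map b = boundary_map b'.
Proof.
case: b b' => [k t] [k' t']; rewrite /boundary_disc /=.
have n0 : 0 < n%:R :> R by rewrite ltr0n face_size.
have turn01 (k1 : 'I_n) (t1 : unit_interval R) :
    0 <= (k1%:R + val t1) / n%:R /\ (k1%:R + val t1) / n%:R <= 1.
  have := interval_itv t1; rewrite set_valE => /andP[t0 t1'].
  have : (k1.+1%:R : R) <= n%:R by rewrite ler_nat.
  rewrite -natr1 => kn; split; first by rewrite divr_ge0 ?addr_ge0 ?ler0n.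
  by rewrite ler_pdivrMr // mul1r; lra.
wlog le_tt' : k k' t t' / (k%:R + val t) / n%:R <= (k'%:R + val t') / n%:R =>
  [H|].
  move=> tt'; have [|/ltW] := leP ((k%:R + val t) / n%:R)
    ((k'%:R + val t') / n%:R) => h.
    exact: H.
  by apply/esym/H.
case/(circle_inj (proj1 (turn01 k t)) le_tt' (proj2 (turn01 k' t'))) =>
  [h|[h0 h1]].
  apply: boundary_map_turn; apply: (mulIf (x := n%:R^-1)) => //.
  by rewrite invr_neq0 // gt_eqF.
have {}h0 : k%:R + val t = 0.
  by move/eqP: h0; rewrite mulf_eq0 invr_eq0 [n%:R == 0]gt_eqF // orbF => /eqP.
have {}h1 : k'%:R + val t' = n%:R.
  by move: h1 => /(congr1 (fun u => u * n%:R)); rewrite mulfVK ?gt_eqF // mul1r.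
have := interval_itv t; have := interval_itv t';
  rewrite !set_valE => /andP[t'0 t'1] /andP[t0 t1].
have k0 := ler0n R k.
have kn : (k'.+1%:R : R) <= n%:R by rewrite ler_nat.
rewrite -natr1 in kn.
have -> : t = zero by apply: interval_eq0; lra.
have t'E : t' = one by apply: interval_eq1; lra.
rewrite t'E boundary_map0 boundary_map1;
  congr (realization_vertex _ _ (corner_at _)).
have k_0 : k = 0%N :> nat by apply/eqP; rewrite -(eqr_nat R); apply/eqP; lra.
have k'n : k'.+1 = n.
  apply/eqP; rewrite -(eqr_nat R) -natr1; apply/eqP.
  move: h1; rewrite t'E /=; lra.
by apply/val_inj; rewrite /= k'n modnn k_0.
Qed.

Lemma cont_boundary_disc k : continuous (fun t => boundary_disc (k, t)).
Proof.
apply: cont_subtype; rewrite set_valE /=.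
have cv := @cont_set_val R `[0, 1]%classic; rewrite set_valE in cv.
have ct : continuous
  (fun t : unit_interval R => 2 * pi * ((k%:R + val t) / n%:R)).
  apply: cont_mul; first exact: cont_cst.
  apply: cont_mul; last exact: cont_cst.
  by apply: cont_add; [exact: cont_cst|exact: cv].
apply: cont_pair; apply: cont_comp ct;
  [exact: continuous_cos|exact: continuous_sin].
Qed.

Lemma cont_boundary_map k : continuous (fun t => boundary_map (k, t)).
Proof. by rewrite /boundary_map /=; exact: cont_segment. Qed.

(** The circle is a finite union of compact arcs, on each of which both maps
    are continuous. *)
Lemma closed_boundary (C : set (realization R e)) : closed C ->
  closed (boundary_disc @` (boundary_map @^-1` C)).
Proof.
move=> cC; have -> : boundary_disc @` (boundary_map @^-1` C) =
    \bigcup_(k in [set: 'I_n]) ((fun t => boundary_disc (k, t)) @`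
      ((fun t => boundary_map (k, t)) @^-1` C)).
  apply/seteqP; split=> [d [[k t] Ct <-]|d [k _ [t Ct <-]]].
    by exists k => //; exists t.
  by exists (k, t).
apply: closed_bigcup => [|k _]; first exact: finite_finset.
apply: compact_subtype_closed; apply: continuous_compact.
  exact/continuous_subspaceT/cont_boundary_disc.
rewrite -[_ @^-1` _]setTI; apply: compact_closedI;
  first exact: interval_compact.
by have /continuous_closedP := @cont_boundary_map k; apply.
Qed.

End Boundary.

(** On a single arc this is the compatibility of [h] with a path of the
    1-skeleton.  From any point one goes back in this way, arc after arc, to the
    first corner. *)
Lemma boundary_transport (h : realization R e -> R -> CW2 R e) (c : faces e) b
  b' :
  path_system z0 (@skeleton R T e) h ->
  transport z0 (fun z => disc_cell c (to_disc z))
    (set_val (boundary_disc (c := c) b)) (set_val (boundary_disc (c := c) b'))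
    (h (boundary_map b)) (h (boundary_map b')).
Proof.
move=> sh.
have glue (b1 : 'I_(size (val c)) * unit_interval R) :
    disc_cell c (boundary_disc b1) = skeleton (boundary_map b1).
  by case: b1 => k t; exact: face_glue.
have side_tr (k : 'I_(size (val c))) (t t' : unit_interval R) :
  transport z0 (fun z => disc_cell c (to_disc z))
    (set_val (boundary_disc (k, t))) (set_val (boundary_disc (k, t')))
    (h (boundary_map (k, t))) (h (boundary_map (k, t'))).
  pose line (s : R) := to_interval ((1 - s) * set_val t + s * set_val t').
  have cl : continuous line.
    by apply: (cont_comp (@cont_to_interval R)); cont.
  have l0 : line 0 = t by rewrite /line subr0 mul1r mul0r addr0 to_intervalK.
  have l1 : line 1 = t' by rewrite /line subrr mul1r mul0r add0r to_intervalK.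
  exists (fun s => set_val (boundary_disc (k, line s))); split;
    rewrite ?l0 ?l1 //.
    apply: (cont_comp (@cont_set_val _ (@disc R))).
    by apply: (cont_comp (@cont_boundary_disc c k)).
  have cm : continuous (fun s => boundary_map (k, line s)).
    by apply: (cont_comp (@cont_boundary_map c k)).
  have := system_square sh cm ler01; rewrite l0 l1.
  by apply: eq_square => // s _ _; rewrite to_discK glue.
have to_start (k : 'I_(size (val c))) (t : unit_interval R)
  (k0 : 'I_(size (val c))) :
  k0 = 0%N :> nat -> transport z0 (fun z => disc_cell c (to_disc z))
    (set_val (boundary_disc (k, t))) (set_val (boundary_disc (k0, zero)))
    (h (boundary_map (k, t))) (h (boundary_map (k0, zero))).
  move=> k00; case: k => k; elim: k t => [|k IH] t kn.
    by rewrite (_ : k0 = Ordinal kn) //; apply/val_inj.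
  apply: (transport_trans (side_tr _ t zero)).
  have kn' : (k < size (val c))%N := ltnW kn.
  have turn : (Ordinal kn)%:R + val (zero : unit_interval R) =
      (Ordinal kn')%:R + val (one : unit_interval R) :> R.
    by rewrite /= addr0 natr1.
  rewrite (boundary_map_turn turn)
    (_ : boundary_disc _ = boundary_disc (Ordinal kn', one)).
    exact: IH.
  by rewrite /boundary_disc turn.
have n0 := face_size c; case: b b' => [k t] [k' t'].
apply: (transport_trans (to_start k t (Ordinal n0) erefl)).
by apply: transport_sym; exact: to_start.
Qed.

Lemma CW2_system : exists h : CW2 R e -> R -> CW2 R e, path_system z0 id h.
Proof.
have [g [gP gE]] := vertex_paths.
have [h sh] := skeleton_system gP gE.
have S := attach_system (V := (R * R)%type) boundary_map_bd
  (fun c => (Ordinal (face_size c), zero))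
  (@cont_set_val _ (@disc R)) (@cont_to_disc R) (@to_discK R) (@cont_stretch R)
  (@open_rim R) (fun c b => stretch_circle _) (fun c b => rim_circle _) _
    closed_boundary
  (f := id : CW2 R e -> CW2 R e) (@cont_id _) sh.
eexists; apply: S => [c d|c b b'].
- case/(rim_stretch (face_size c)) => k [s kd].
  by exists (k, s).
- exact: boundary_transport.
Qed.

End VertexSystem.

Theorem corollary4p22 (R : realType) (T : finType) (e : rel T)
    (e_irr : irreflexive e) (e_sym : symmetric e)
    (T_nonempty : (0 < #|T|)%N) (e_conn : forall x y : T, connect e x y)
    (MH2_eq0 : forall k : nat, (2 < k)%N -> forall h : MH e 2 k, h = 0) :
  simply_connected R (CW2 R e).
Proof.
have /card_gt0P[x0 _] := T_nonempty.
have [h sh] := CW2_system R e_irr e_sym e_conn MH2_eq0 x0.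
exact: system_simply_connected sh.
Qed.
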